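(* Let $\mathcal{H}$ be a separable Hilbert space (of finite or infinite dimension) over $\mathbb{F}=\mathbb{R}$ or $\mathbb{C}$. Let $1\le p<\infty$ and let $q$ satisfy $1/p+1/q=1$ (with $q=\infty$ if $p=1$). Let $n\ge1$, let $\mathbf{A}_1,\dots,\mathbf{A}_n\in\mathcal{S}_p$ be self-adjoint and $\beta_1,\dots,\beta_n\in\mathbb{F}$, and let $$\mathcal{C}=\{\mathbf{P}\in\mathcal{P}_q : \operatorname{Tr}\mathbf{P}\mathbf{A}_j=\beta_j\text{ for }j=1,\dots,n\}.$$ Let $\mathbf{P}\in\mathcal{C}$. Then $\mathbf{P}$ is an extreme point of $\mathcal{C}$ if and only if all of the following hold: 1. $\operatorname{rank}\mathbf{P}<\infty$; 2. if $\mathbb{F}=\mathbb{R}$, then $\operatorname{rank}\left[\operatorname{Tr}\mathbf{P}\mathbf{A}_i\mathbf{P}\mathbf{A}_j\right]_{i,j=1}^n=\tfrac12(\operatorname{rank}\mathbf{P})(1+\operatorname{rank}\mathbf{P})$; 3. if $\mathbb{F}=\mathbb{C}$, then $\operatorname{rank}\left[\operatorname{Tr}\mathbf{P}\mathbf{A}_i\mathbf{P}\mathbf{A}_j\right]_{i,j=1}^n=(\operatorname{rank}\mathbf{P})^2$.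
   Context: For $1\le p<\infty$, $\mathcal{S}_p$ is the Schatten class (trace ideal) of compact operators $\mathbf{A}$ on $\mathcal{H}$ with $\operatorname{Tr}|\mathbf{A}|^p<\infty$, where $|\mathbf{A}|=(\mathbf{A}^*\mathbf{A})^{1/2}$; $\mathcal{S}_\infty$ is the space of compact operators. $\mathcal{P}$ is the set of positive operators (self-adjoint with $\langle x,\mathbf{P}x\rangle\ge0$ for all $x$), and $\mathcal{P}_q=\mathcal{P}\cap\mathcal{S}_q$. The notation $[m_{ij}]_{i,j=1}^n$ denotes the $n\times n$ matrix with entries $m_{ij}$. A point of a convex set $\mathcal{C}$ is extreme if it cannot be written as $\alpha p_1+(1-\alpha)p_2$ with $\alpha\in(0,1)$ and distinct $p_1,p_2\in\mathcal{C}$. *)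

(* Defs.v *)
From HB Require Import structures.
From mathcomp Require Import all_boot all_order all_algebra.
From mathcomp Require Import complex.
From mathcomp Require Import all_classical all_reals all_analysis.

Set Implicit Arguments.
Unset Strict Implicit.
Unset Printing Implicit Defensive.

Import Order.TTheory GRing.Theory Num.Theory.
Import numFieldNormedType.Exports.

Local Open Scope classical_set_scope.
Local Open Scope ring_scope.

Variant scalar_kind := RealScalars | ComplexScalars.

Definition scalars (R : realType) (F : scalar_kind) : numFieldType :=
  match F with RealScalars => R | ComplexScalars => R[i] end.

Definition conj_scalar (R : realType) (F : scalar_kind) :
    scalars R F -> scalars R F :=
  match F with RealScalars => fun x => x | ComplexScalars => @conjc R end.

Definition of_real (R : realType) (F : scalar_kind) : R -> scalars R F :=
  match F with RealScalars => fun x => x | ComplexScalars => real_complex R end.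

(* In R[i], [0 < a < 1] for the library's partial order forces [a] to be real,
   so quantifying over scalars [a] is quantifying over reals in (0,1). *)
Definition extreme_point (K : numDomainType) (V : lmodType K)
    (C : set V) (x : V) : Prop :=
  C x /\ forall (a : K) (y z : V), 0 < a < 1 -> C y -> C z ->
    x = a *: y + (1 - a) *: z -> y = z.

Definition separable (T : topologicalType) : Prop :=
  exists D : set T, countable D /\ dense D.

Section HilbertSpace.
Context (R : realType) (F : scalar_kind).
Local Notation K := (scalars R F).
Context (H : completeNormedModType K).

Definition bounded_operator (T : H -> H) : Prop := linear T /\ continuous T.

Definition compact_operator (T : H -> H) : Prop :=
  bounded_operator T /\ precompact (T @` [set x | `|x| <= 1]).

Definition has_rank (T : H -> H) (r : nat) : Prop :=
  exists b : 'I_r -> H,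
    (forall c : 'I_r -> K, \sum_i c i *: b i = 0 -> forall i, c i = 0) /\
    range T = range (fun c : 'I_r -> K => \sum_i c i *: b i).

Definition finite_rank (T : H -> H) : Prop := exists r, has_rank T r.

(* Meaningful only under [finite_rank]; 0 otherwise. *)
Definition op_rank (T : H -> H) : nat := xget 0%N (has_rank T).

(* The inner product is linear in its first argument and conjugate-linear in
   the second, as in the library's [{dot _ for _}]. *)
Context (dot : {dot H for @conj_scalar R F}).

Definition adjoint_of (T T' : H -> H) : Prop :=
  bounded_operator T' /\ forall x y, dot (T x) y = dot x (T' y).

Definition selfadjoint (T : H -> H) : Prop := adjoint_of T T.

(* [0 <= z] in R[i] means that [z] is real and nonnegative. *)
Definition positive_operator (P : H -> H) : Prop :=
  [/\ bounded_operator P, selfadjoint P & forall x, 0 <= dot x (P x)].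

(* Orthonormal bases of a separable space, indexed by [nat] in every dimension:
   the nonzero terms of [e] are the basis vectors, and in finite dimension all
   but finitely many terms are 0. The zero terms do not contribute to the sums
   below. *)
Definition orthonormal_basis (e : nat -> H) : Prop :=
  [/\ forall i j, i != j -> dot (e i) (e j) = 0,
      forall i, e i = 0 \/ `|e i| = 1 &
      forall x, (forall i, dot x (e i) = 0) -> x = 0].

(* The trace exists when the diagonal sums converge to the same value in all
   orthonormal bases. *)
Definition has_trace (T : H -> H) (t : K) : Prop :=
  forall e, orthonormal_basis e ->
    series (fun i => dot (T (e i)) (e i)) @ \oo --> t.

Definition trace (T : H -> H) : K := xget 0 (has_trace T).

(* [B] is |A|, the positive square root of A^*A. *)
Definition is_abs (A B : H -> H) : Prop :=
  positive_operator B /\ exists A', adjoint_of A A' /\ B \o B = A' \o A.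

(* [T] is [B] to the power [p], by the functional calculus of the positive
   diagonalizable operator [B]. *)
Definition is_power (B : H -> H) (p : R) (T : H -> H) : Prop :=
  bounded_operator T /\
  exists (e : nat -> H) (l : nat -> R),
    [/\ orthonormal_basis e, forall i, 0 <= l i,
        forall i, B (e i) = of_real F (l i) *: e i &
        forall i, T (e i) = of_real F (l i `^ p) *: e i].

Definition schatten (p : \bar R) : set (H -> H) :=
  match p with
  | r%:E => [set A | compact_operator A /\
      exists B T, [/\ is_abs A B, is_power B r T & exists t, has_trace T t]]
  | +oo%E => [set A | compact_operator A]
  | -oo%E => set0
  end.

Definition feasible_set (q : \bar R) (n : nat) (A : 'I_n -> H -> H)
    (beta : 'I_n -> K) : set (H -> H) :=
  [set P | [/\ positive_operator P, schatten q P &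
               forall j, trace (P \o A j) = beta j]].

End HilbertSpace.

(* Main.v *)
(* A positive operator of rank r is a sum of r rank one operators <., v_k> v_k
   with v_1, ..., v_r independent.  If P = a Y + (1 - a) Z with Y, Z positive, then Y and Z vanish
   on ker P, so they are given by Hermitian r x r matrices in the family (v_k).
   For an operator D with matrix X, Tr D A_j is the inner product of X with the
   compression a_j = [<A_j v_k, v_l>], and Tr P A_i P A_j is the inner product of
   a_i with a_j.  Hence P is extreme if and only if no nonzero Hermitian X is
   orthogonal to all the a_j, i.e. the a_j span the Hermitian matrices, and the
   dimension of their span is the rank of their Gram matrix.  If instead P has
   rank larger than n, then n + 1 independent vectors in the range of P already
   carry a Hermitian X orthogonal to the a_j, and P + eps D, P - eps D are both
   feasible for small eps.  For finite q the vectors are taken among eigenvectors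
   of P, so that the perturbed operator is diagonalized by a rotation of finitely
   many basis vectors. *)

From HB Require Import structures.
Require Import Defs.
From mathcomp Require Import all_boot all_order all_algebra.
From mathcomp Require Import complex.
From mathcomp Require Import ring zify.
From mathcomp Require Import all_classical all_reals all_analysis.

Set Implicit Arguments.
Unset Strict Implicit.
Unset Printing Implicit Defensive.

Import Order.TTheory GRing.Theory Num.Theory.
Import numFieldNormedType.Exports.

Local Open Scope classical_set_scope.
Local Open Scope ring_scope.

(** * Scalars *)

Section ScalarFacts.
Context {R : realType} {F : scalar_kind}.
Local Notation K := (scalars R F).
Local Notation conj := (@conj_scalar R F).
Local Notation ofR := (@of_real R F).

Lemma conj_scalar_is_zmod_morphism : zmod_morphism conj.
Proof. by case: F => //= x y; rewrite rmorphB. Qed.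

HB.instance Definition _ :=
  GRing.isZmodMorphism.Build K K conj conj_scalar_is_zmod_morphism.

Lemma conj_scalar_is_monoid_morphism : monoid_morphism conj.
Proof. by case: F => //=; split => [|x y]; rewrite ?rmorph1 ?rmorphM. Qed.

HB.instance Definition _ :=
  GRing.isMonoidMorphism.Build K K conj conj_scalar_is_monoid_morphism.

Lemma conjD (x y : K) : conj (x + y) = conj x + conj y.
Proof. exact: rmorphD. Qed.
Lemma conjB (x y : K) : conj (x - y) = conj x - conj y.
Proof. exact: rmorphB. Qed.
Lemma conjM (x y : K) : conj (x * y) = conj x * conj y.
Proof. exact: rmorphM. Qed.
Lemma conjV (x : K) : conj x^-1 = (conj x)^-1.
Proof. exact: fmorphV. Qed.
Lemma conj0 : conj 0 = 0. Proof. exact: rmorph0. Qed.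
Lemma conj_sum I r (Q : pred I) (E : I -> K) :
  conj (\sum_(i <- r | Q i) E i) = \sum_(i <- r | Q i) conj (E i).
Proof. exact: rmorph_sum. Qed.

Lemma of_real_is_zmod_morphism : zmod_morphism ofR.
Proof. by case: F => //= x y; rewrite rmorphB. Qed.

HB.instance Definition _ :=
  GRing.isZmodMorphism.Build R K ofR of_real_is_zmod_morphism.

Lemma of_real_is_monoid_morphism : monoid_morphism ofR.
Proof. by case: F => //=; split => [|x y]; rewrite ?rmorph1 ?rmorphM. Qed.

HB.instance Definition _ :=
  GRing.isMonoidMorphism.Build R K ofR of_real_is_monoid_morphism.

Lemma conj_scalarK : involutive conj.
Proof. by case: F => //=; exact: conjcK. Qed.

Lemma mul_conj_scalar (x : K) : x * conj x = `|x| ^+ 2.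
Proof.
case: F x => //= x; first by rewrite real_normK ?num_real// expr2.
by rewrite sqr_normc.
Qed.

Lemma conj_scalar_real (x : K) : x \is Num.real -> conj x = x.
Proof.
case: F x => //= x /complex_realP[r ->]; by rewrite conjc_real.
Qed.

Lemma of_realP (x : K) : conj x = x -> exists r, x = ofR r.
Proof.
case: F x => //= x; first by exists x.
case: x => a b /= [] /eqP; rewrite eq_sym -addr_eq0 -mulr2n mulrn_eq0 /= => /eqP ->.
by exists a.
Qed.

Lemma ler_of_real (x y : R) : (ofR x <= ofR y) = (x <= y).
Proof. by case: F => //=; exact: lecR. Qed.

Lemma conj_of_real (x : R) : conj (ofR x) = ofR x.
Proof. by case: F => //=; exact: conjc_real. Qed.

Lemma ltr_of_real (x y : R) : (ofR x < ofR y) = (x < y).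
Proof. by case: F => //=; exact: ltcR. Qed.

Lemma of_real_ge0 (x : K) : 0 <= x -> exists2 r, 0 <= r & x = ofR r.
Proof.
move=> x0; have [r xr] := of_realP (conj_scalar_real (ger0_real x0)).
by exists r => //; rewrite -ler_of_real rmorph0 -xr.
Qed.

Lemma normr_conj_scalar (x : K) : `|conj x| = `|x|.
Proof.
by apply/eqP; rewrite -(@eqrXn2 _ 2)// -!mul_conj_scalar conj_scalarK mulrC.
Qed.

End ScalarFacts.

(** * Inner products *)

Section RawLinear.
Context {K : nzRingType} {U V : lmodType K} (f : U -> V) (f_lin : linear f).

Let f' : {linear U -> V} := HB.pack f (GRing.isLinear.Build K U V *:%R f f_lin).

Lemma linD x y : f (x + y) = f x + f y. Proof. exact: (linearD f'). Qed.
Lemma linB x y : f (x - y) = f x - f y. Proof. exact: (linearB f'). Qed.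
Lemma linZ a x : f (a *: x) = a *: f x. Proof. exact: (linearZZ f'). Qed.
Lemma lin_sum I r (Q : pred I) (E : I -> U) :
  f (\sum_(i <- r | Q i) E i) = \sum_(i <- r | Q i) f (E i).
Proof. exact: (linear_sum f'). Qed.
End RawLinear.

Lemma lin_bounded_continuous (K : numFieldType) (V W : normedModType K)
    (f : V -> W) (M : K) :
  linear f -> (forall x, `|f x| <= M * `|x|) -> continuous f.
Proof.
move=> f_lin fM.
pose f' : {linear V -> W} := HB.pack f (GRing.isLinear.Build K V W *:%R f f_lin).
apply: (@bounded_linear_continuous _ _ _ f').
(* [M] has no known sign in a trivial space, hence the absolute value; a nonzero [x] forces
   [0 <= M]. *)
apply/bounded_funP => r; exists (`|M| * r) => x xr.
apply: le_trans (fM x) _.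
have [->|x0] := eqVneq x 0.
  by rewrite normr0 mulr0 mulr_ge0// -(normr0 V) ?(le_trans _ xr)// normr0.
have M0 : 0 <= M.
  by have := le_trans (normr_ge0 _) (fM x); rewrite pmulr_lge0// normr_gt0.
by rewrite ger0_norm// ler_wpM2l.
Qed.

Section Dot.
Context {R : realType} {F : scalar_kind}.
Local Notation K := (scalars R F).
Local Notation conj := (@conj_scalar R F).
Context {H : completeNormedModType K} (dot : {dot H for @conj_scalar R F}).

Lemma dotDl x y z : dot (x + y) z = dot x z + dot y z.
Proof. exact: linearDl. Qed.
Lemma dotBl x y z : dot (x - y) z = dot x z - dot y z.
Proof. exact: linearBl. Qed.
Lemma dotDr x y z : dot x (y + z) = dot x y + dot x z.
Proof. exact: linearDr. Qed.
Lemma dotBr x y z : dot x (y - z) = dot x y - dot x z.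
Proof. exact: linearBr. Qed.
Lemma dotZl a x y : dot (a *: x) y = a * dot x y.
Proof. exact: linearZl_LR. Qed.
Lemma dotZr a x y : dot x (a *: y) = conj a * dot x y.
Proof. exact: linearZr_LR. Qed.
Lemma dot0l x : dot 0 x = 0. Proof. exact: linear0l. Qed.
Lemma dot0r x : dot x 0 = 0. Proof. exact: linear0r. Qed.
Lemma dot_suml I r (Q : pred I) (E : I -> H) y :
  dot (\sum_(i <- r | Q i) E i) y = \sum_(i <- r | Q i) dot (E i) y.
Proof. exact: linear_sumlz. Qed.
Lemma dot_sumr I r (Q : pred I) (E : I -> H) y :
  dot y (\sum_(i <- r | Q i) E i) = \sum_(i <- r | Q i) dot y (E i).
Proof. exact: linear_sumr. Qed.
Lemma dotC x y : dot x y = conj (dot y x).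
Proof. by rewrite hermC expr0 mul1r. Qed.
Lemma dot_gt0 x : x != 0 -> 0 < dot x x.
Proof. exact: neq0_dnorm_gt0. Qed.
Lemma dot_ge0 x : 0 <= dot x x.
Proof. by have [->|/dot_gt0/ltW//] := eqVneq x 0; rewrite dot0l. Qed.
Lemma dot_eq0 x : dot x x = 0 -> x = 0.
Proof. by have [//|/dot_gt0 + e] := eqVneq x 0; rewrite e ltxx. Qed.

Lemma dot_inj x y : (forall z, dot x z = dot y z) -> x = y.
Proof.
by move=> h; apply/eqP; rewrite -subr_eq0; apply/eqP/dot_eq0; rewrite dotBl h subrr.
Qed.

Lemma dot_herm_ge0 T x : 0 <= dot x (T x) -> dot (T x) x = dot x (T x).
Proof. by move=> h; rewrite dotC conj_scalar_real// ger0_real. Qed.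

(** The form of [T] is nonnegative at [x - t *: y] for every scalar [t], and a good choice of [t]
    gives the inequality. The form may be degenerate, so <Ty, y> = 0 is a separate case. *)
Lemma positive_cauchy_schwarz (T : H -> H) x y :
  linear T -> (forall x y, dot (T x) y = dot x (T y)) ->
  (forall x, 0 <= dot x (T x)) ->
  `|dot (T x) y| ^+ 2 <= dot (T x) x * dot (T y) y.
Proof.
move=> T_lin T_sym T_ge0; pose z := dot (T x) y.
have pos t : 0 <= dot (T x) x - conj t * z - t * conj z + t * conj t * dot (T y) y.
  have := T_ge0 (x - t *: y).
  rewrite (linB T_lin) (linZ T_lin) !(dotBl, dotBr, dotZl, dotZr).
  rewrite -!T_sym -/z [dot (T y) x]T_sym [dot y (T x)]dotC -/z.
  by rewrite mulrA opprB addrA addrAC.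
have a0 : 0 <= dot (T x) x by rewrite dot_herm_ge0.
have b0 : 0 <= dot (T y) y by rewrite dot_herm_ge0.
rewrite -/z; have [b_0|b_neq0] := eqVneq (dot (T y) y) 0.
  have [->|z0] := eqVneq z 0; first by rewrite normr0 expr0n mulr_ge0.
  (* Without the quadratic term, this [t] makes the expression -(<Tx, x> + 2), which is negative. *)
  have := pos (z * (dot (T x) x + 1) / `|z| ^+ 2).
  have zz : `|z| ^+ 2 != 0 by rewrite expf_neq0// normr_eq0.
  have -> : conj (z * (dot (T x) x + 1) / `|z| ^+ 2)
     = conj z * (dot (T x) x + 1) / `|z| ^+ 2.
    rewrite !conjM conjV [conj (_ + 1)]conj_scalar_real ?realD ?ger0_real//.
    by rewrite [conj (_ ^+ 2)]conj_scalar_real ?realX ?normr_real.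
  set a := dot (T x) x in a0 *.
  rewrite b_0 mulr0 addr0.
  rewrite [z * _ / _ * _](_ : _ = a + 1); last first.
    have -> : z * (a + 1) / `|z| ^+ 2 * conj z
      = z * conj z / `|z| ^+ 2 * (a + 1) by ring.
    by rewrite mul_conj_scalar divff// mul1r.
  rewrite [conj z * _ / _ * _](_ : _ = a + 1); last first.
    have -> : conj z * (a + 1) / `|z| ^+ 2 * z
      = z * conj z / `|z| ^+ 2 * (a + 1) by ring.
    by rewrite mul_conj_scalar divff// mul1r.
  have -> : a - (a + 1) - (a + 1) = - (a + 2%:R) by ring.
  by rewrite oppr_ge0 lt_geF// ltr_wpDl// ltr0n.
have b_gt0 : 0 < dot (T y) y by rewrite lt_def b_neq0.
(* The minimizer of the quadratic expression in [t]. *)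
have := pos (z / dot (T y) y).
rewrite conjM conjV [conj (dot (T y) y)]conj_scalar_real ?ger0_real//.
set a := dot (T x) x in a0 *; set b := dot (T y) y in b_neq0 b_gt0 *.
have -> : a - conj z / b * z - z / b * conj z + z / b * (conj z / b) * b
   = a - z * conj z / b.
  by rewrite -[z / b * _ * b]mulrA divfK//; ring.
by rewrite mul_conj_scalar subr_ge0 ler_pdivrMr.
Qed.

(** Cauchy-Schwarz for the form of [T] at [x] and [T x] bounds the square of <Tx, Tx> by 0. *)
Lemma positive_dot_eq0 (T : H -> H) x :
  linear T -> (forall x y, dot (T x) y = dot x (T y)) ->
  (forall x, 0 <= dot x (T x)) -> dot (T x) x = 0 -> T x = 0.
Proof.
move=> T_lin T_sym T_ge0 e; apply: dot_eq0.
have := positive_cauchy_schwarz x (T x) T_lin T_sym T_ge0.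
by rewrite e mul0r -normrX normr_le0 expf_eq0 /= => /eqP.
Qed.

Hypothesis dot_norm : forall x : H, dot x x = `|x| ^+ 2.

Lemma cauchy_schwarz x y : `|dot x y| <= `|x| * `|y|.
Proof.
have := @positive_cauchy_schwarz id x y _ _ _; rewrite !dot_norm => h.
by rewrite -(@ler_pXn2r _ 2) ?nnegrE ?mulr_ge0// exprMn h// => z; exact: dot_ge0.
Qed.

Lemma normr_dot (x : H) (z : K) : 0 <= z -> z ^+ 2 = dot x x -> `|x| = z.
Proof.
by move=> z0 e; apply/eqP; rewrite -(@eqrXn2 _ 2)// e dot_norm.
Qed.

Lemma dotl_continuous y : continuous (fun x => dot x y : K).
Proof.
apply: (@lin_bounded_continuous _ _ K^o _ `|y|).
  by move=> a u v; rewrite dotDl dotZl.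
by move=> x; rewrite mulrC cauchy_schwarz.
Qed.

End Dot.

(** * Parseval's identity and traces *)

Section Parseval.
Context {R : realType} {F : scalar_kind}.
Local Notation K := (scalars R F).
Local Notation conj := (@conj_scalar R F).
Context {H : completeNormedModType K} (dot : {dot H for @conj_scalar R F}).
Hypothesis dot_norm : forall x : H, dot x x = `|x| ^+ 2.

Lemma cvg_dotl (u : nat -> H) (s y : H) :
  u @ \oo --> s -> (fun n => dot (u n) y) @ \oo --> dot s y.
Proof.
by move=> us; apply: (@continuous_cvg _ _ _ _ _ u (fun z => dot z y : K) s _ us);
  exact: (dotl_continuous dot_norm).
Qed.

Variables (e : nat -> H) (e_onb : orthonormal_basis dot e).

Let e_ortho i j : i != j -> dot (e i) (e j) = 0.
Proof. by case: e_onb => h _ _; exact: h. Qed.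

(** The norm of [e i] is 0 or 1 and the identity holds in both cases, so the zero terms need no
    separate treatment below. *)
Lemma onb_dotZ x i : dot x (e i) * dot (e i) (e i) = dot x (e i).
Proof.
case: e_onb => _ /(_ i) [->|n1] _; first by rewrite !dot0r mul0r.
by rewrite dot_norm n1 expr1n mulr1.
Qed.

Lemma dot_onb_sum x m n j :
  dot (\sum_(m <= i < n) dot x (e i) *: e i) (e j)
  = if (m <= j < n)%N then dot x (e j) else 0.
Proof.
rewrite dot_suml; under eq_bigr do rewrite dotZl.
have [mjn|mjn] := boolP (m <= j < n)%N.
  rewrite (bigD1_seq j) ?mem_index_iota ?iota_uniq//= onb_dotZ big1 ?addr0//.
  by move=> i /e_ortho ->; rewrite mulr0.
rewrite big_seq big1// => i; rewrite mem_index_iota => imn.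
by rewrite e_ortho ?mulr0//; apply: contraNneq mjn => <-.
Qed.

Lemma dot_onb_suml x y m n :
  dot (\sum_(m <= i < n) dot x (e i) *: e i) y
  = \sum_(m <= i < n) dot x (e i) * dot (e i) y.
Proof. by rewrite dot_suml; under eq_bigr do rewrite dotZl. Qed.

Lemma dot_onb_sums x m n (S := \sum_(m <= i < n) dot x (e i) *: e i) :
  dot S S = \sum_(m <= i < n) `|dot x (e i)| ^+ 2.
Proof.
rewrite {1}/S dot_onb_suml big_seq [RHS]big_seq; apply: eq_bigr => i.
rewrite mem_index_iota => imn.
by rewrite [dot (e i) _]dotC dot_onb_sum imn mul_conj_scalar.
Qed.

(** The partial sum [S] satisfies <S, x> = <S, S>, so <x - S, x - S> = <x, x> - <S, S>. *)
Lemma bessel x n : \sum_(0 <= i < n) `|dot x (e i)| ^+ 2 <= dot x x.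
Proof.
pose S := \sum_(0 <= i < n) dot x (e i) *: e i.
have SS := dot_onb_sums x 0 n; rewrite -/S in SS.
have Sx : dot S x = dot S S.
  rewrite SS dot_onb_suml; apply: eq_bigr => i _.
  by rewrite [dot (e i) x]dotC mul_conj_scalar.
rewrite -SS -subr_ge0.
have := dot_ge0 dot (x - S).
by rewrite !(dotBl, dotBr) Sx subrr subr0 [dot x S]dotC Sx -dotC.
Qed.

(** The squared coefficients are moved to [R], where a nondecreasing series bounded by Bessel
    converges. By Pythagoras its Cauchy criterion at eps^2 is that of the vector series at eps. *)
Lemma onb_series_cauchy x : cauchy (series (fun i => dot x (e i) *: e i) @ \oo).
Proof.
have /choice [r rE] i : exists r : R, `|dot x (e i)| ^+ 2 = of_real F r.
  by have [r _ ->] := of_real_ge0 (exprn_ge0 2 (normr_ge0 (dot x (e i)))); exists r.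
have r_ge0 i : 0 <= r i by rewrite -(@ler_of_real R F) rmorph0 -rE exprn_ge0.
have /cvg_cauchy/cauchy_seriesP r_cauchy : cvgn (series r).
  apply: nondecreasing_is_cvgn; first exact: nondecreasing_series.
  have [M _ xM] := of_real_ge0 (dot_ge0 dot x).
  exists M => _ [n _ <-]; rewrite -(@ler_of_real R F) -xM.
  apply: le_trans (bessel x n); rewrite /series /= rmorph_sum /=.
  by under eq_bigr do rewrite -rE.
apply/cauchy_seriesP => eps' eps_gt0.
have [eps eps_ge0 epsE] := of_real_ge0 (ltW eps_gt0).
have {}eps_gt0 : 0 < eps by rewrite -(@ltr_of_real R F) rmorph0 -epsE.
apply: filterS (r_cauchy _ (exprn_gt0 2 eps_gt0)) => -[m n] /=.
rewrite ger0_norm ?sumr_ge0// -(@ltr_of_real R F) rmorph_sum rmorphXn /= -epsE.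
under eq_bigr do rewrite -rE.
by rewrite -dot_onb_sums dot_norm ltr_pXn2r ?nnegrE// epsE -(rmorph0 (@of_real R F)) ler_of_real.
Qed.

(** The series has a limit by completeness. Coefficient [j] of the partial sums is constant beyond
    [j], so the limit has the coefficients of [x], and the basis is total. *)
Lemma onb_expansion x : series (fun i => dot x (e i) *: e i) @ \oo --> x.
Proof.
have /cauchy_cvgP/cvg_ex[s xs] := onb_series_cauchy x.
suff xE : x = s by rewrite -xE in xs.
apply/eqP; rewrite -subr_eq0; apply/eqP.
have [_ _ total] := e_onb; apply: total => j; rewrite dotBl; apply/eqP.
rewrite subr_eq0 eq_sym; apply/eqP.
apply: (@cvg_unique _ (@norm_hausdorff _ _)
  ((fun n => dot (series (fun i => dot x (e i) *: e i) n) (e j)) @ \oo)).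
  exact: cvg_dotl.
apply: cvg_near_cst; near=> n.
rewrite /series /= dot_onb_sum leq0n /=.
suff -> : (j < n)%N by [].
by near: n; exact: nbhs_infty_gt.
Unshelve. all: by end_near. Qed.

Lemma parseval x y :
  series (fun i => dot x (e i) * dot (e i) y) @ \oo --> dot x y.
Proof.
have -> : series (fun i => dot x (e i) * dot (e i) y)
  = (fun n => dot (series (fun i => dot x (e i) *: e i) n) y).
  by apply/funext => n; rewrite /series /= dot_onb_suml.
by apply: cvg_dotl; exact: onb_expansion.
Qed.

End Parseval.

(** * Existence and uniqueness of traces *)

Section Trace.
Context {R : realType} {F : scalar_kind}.
Local Notation K := (scalars R F).
Local Notation conj := (@conj_scalar R F).
Context {H : completeNormedModType K} (dot : {dot H for @conj_scalar R F}).

Lemma has_traceD (S T : H -> H) (s t : K) : has_trace dot S s ->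
  has_trace dot T t -> has_trace dot (fun x => S x + T x) (s + t).
Proof.
move=> hs ht e e_onb.
have -> : series (fun i => dot (S (e i) + T (e i)) (e i)) =
    series (fun i => dot (S (e i)) (e i)) \+ series (fun i => dot (T (e i)) (e i)).
  apply/funext => n; rewrite /series /= -big_split /=.
  by apply: eq_bigr => i _; rewrite dotDl.
by apply: cvgD; [exact: hs|exact: ht].
Qed.

Lemma has_trace0 : has_trace dot (fun=> 0) 0.
Proof.
move=> e _; apply: cvg_near_cst; near=> n.
by rewrite /series /= big1// => i _; rewrite dot0l.
Unshelve. all: by end_near. Qed.

Lemma has_trace_sum m (T : 'I_m -> H -> H) (t : 'I_m -> K) :
  (forall k, has_trace dot (T k) (t k)) ->
  has_trace dot (fun x => \sum_k T k x) (\sum_k t k).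
Proof.
elim: m T t => [|m IH] T t h.
  rewrite big_ord0 (_ : (fun x => _) = fun=> 0); first exact: has_trace0.
  by apply/funext => x; rewrite big_ord0.
rewrite big_ord_recl (_ : (fun x => _) =
    fun x => T ord0 x + \sum_(k < m) T (lift ord0 k) x).
  by apply: has_traceD; [exact: h|apply: IH => k; exact: h].
by apply/funext => x; rewrite big_ord_recl.
Qed.

(** A basis has to be at hand: without one, every scalar would be a trace vacuously. *)
Lemma trace_unique e (T : H -> H) (t : K) :
  orthonormal_basis dot e -> has_trace dot T t -> trace dot T = t.
Proof.
move=> e_onb Tt; apply: xget_unique => // s Ts.
apply: (@cvg_unique _ (@norm_hausdorff _ _) _ _ _ _ (Ts _ e_onb) (Tt _ e_onb)).
Qed.

Lemma has_trace_eq (S T : H -> H) :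
  (forall t, has_trace dot S t <-> has_trace dot T t) -> trace dot S = trace dot T.
Proof.
by move=> h; rewrite /trace; congr xget; apply/funext => t; exact/propext.
Qed.

Hypothesis dot_norm : forall x : H, dot x x = `|x| ^+ 2.

(** In every basis the diagonal sums are [a] times the Parseval series of <v, A u>, so the limit
    does not depend on the basis. *)
Lemma has_trace_rank1 (A : H -> H) (u v : H) (a : K) :
  (forall x y, dot (A x) y = dot x (A y)) ->
  has_trace dot (fun x => (a * dot (A x) u) *: v) (a * dot v (A u)).
Proof.
move=> A_sym e e_onb.
have -> : series (fun i => dot ((a * dot (A (e i)) u) *: v) (e i)) =
    (fun n => a * series (fun i => dot v (e i) * dot (e i) (A u)) n).
  apply/funext => n; rewrite /series /= mulr_sumr; apply: eq_bigr => i _.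
  by rewrite dotZl A_sym -mulrA; congr (_ * _); rewrite mulrC.
by apply: cvgMr; exact: parseval.
Qed.

End Trace.

(** * Finite rank operators *)

Definition conj_symmetric (R : realType) (F : scalar_kind) m
    (X : 'M[scalars R F]_m) : Prop :=
  forall k l, X l k = conj_scalar (X k l).

Section FiniteOperator.
Context {R : realType} {F : scalar_kind}.
Local Notation K := (scalars R F).
Local Notation conj := (@conj_scalar R F).
Context {H : completeNormedModType K} (dot : {dot H for @conj_scalar R F}).

(** With V c the combination of the [v l] with coefficients [c], this is V X^T V^*; the identity
    matrix gives V V^*, the shape of a Cholesky factorization. *)
Definition fop m (v : 'I_m -> H) (X : 'M[K]_m) (x : H) : H :=
  \sum_k \sum_l (X k l * dot x (v k)) *: v l.

Lemma dot_fopl m (v : 'I_m -> H) X x y :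
  dot (fop v X x) y = \sum_k \sum_l X k l * dot x (v k) * dot (v l) y.
Proof.
rewrite dot_suml; apply: eq_bigr => k _; rewrite dot_suml.
by apply: eq_bigr => l _; rewrite dotZl.
Qed.

Lemma fop_linear m (v : 'I_m -> H) X : linear (fop v X).
Proof.
move=> a x y; rewrite /fop scaler_sumr -big_split; apply: eq_bigr => k _ /=.
rewrite scaler_sumr -big_split; apply: eq_bigr => l _ /=.
by rewrite dotDl dotZl mulrDr scalerDl scalerA mulrCA.
Qed.

Lemma fop_sym m (v : 'I_m -> H) X x y : conj_symmetric X ->
  dot (fop v X x) y = dot x (fop v X y).
Proof.
move=> X_sym; rewrite [RHS]dotC !dot_fopl exchange_big conj_sum.
apply: eq_bigr => k _; rewrite conj_sum; apply: eq_bigr => l _.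
by rewrite !conjM -X_sym -!dotC mulrAC.
Qed.

Lemma fopZ m (v : 'I_m -> H) X a x : fop v (a *: X) x = a *: fop v X x.
Proof.
rewrite /fop scaler_sumr; apply: eq_bigr => k _; rewrite scaler_sumr.
by apply: eq_bigr => l _; rewrite mxE scalerA mulrA.
Qed.

Lemma fop_id m (v : 'I_m -> H) x : fop v 1%:M x = \sum_k dot x (v k) *: v k.
Proof.
apply: eq_bigr => k _; rewrite (bigD1 k)//= mxE eqxx mul1r big1 ?addr0// => l.
by rewrite eq_sym mxE => /negPf ->; rewrite mul0r scale0r.
Qed.

Lemma fop_biorth m (v w : 'I_m -> H) X k l :
  (forall k l, dot (w k) (v l) = (k == l)%:R) -> dot (fop v X (w k)) (w l) = X k l.
Proof.
move=> wv; rewrite dot_fopl (bigD1 k)//= (bigD1 l)//= wv eqxx mulr1.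
rewrite [dot (v l) _]dotC wv eqxx rmorph1 mulr1.
rewrite [X in _ + X + _]big1 => [|i /negPf li]; last first.
  by rewrite [dot (v i) _]dotC wv [l == i]eq_sym li rmorph0 mulr0.
rewrite addr0 big1 ?addr0// => i /negPf ki; rewrite big1// => j _.
by rewrite wv [k == i]eq_sym ki mulr0 mul0r.
Qed.

Lemma has_trace_fop m (v : 'I_m -> H) X (A : H -> H) :
  (forall x : H, dot x x = `|x| ^+ 2) ->
  (forall x y, dot (A x) y = dot x (A y)) ->
  has_trace dot (fop v X \o A) (\sum_k \sum_l X k l * dot (v l) (A (v k))).
Proof.
move=> dot_norm A_sym; apply: has_trace_sum => k; apply: has_trace_sum => l.
exact: has_trace_rank1.
Qed.

Hypothesis dot_norm : forall x : H, dot x x = `|x| ^+ 2.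

Lemma fop_continuous m (v : 'I_m -> H) X : continuous (fop v X).
Proof.
apply: (@lin_bounded_continuous _ _ _ _ (\sum_k \sum_l `|X k l| * `|v k| * `|v l|)).
  exact: fop_linear.
move=> x; rewrite mulr_suml; apply: le_trans (ler_norm_sum _ _ _) _.
apply: ler_sum => k _; rewrite mulr_suml; apply: le_trans (ler_norm_sum _ _ _) _.
apply: ler_sum => l _; rewrite normrZ normrM mulrAC -!mulrA ler_wpM2l//.
by rewrite mulrCA ler_wpM2l// mulrC cauchy_schwarz.
Qed.

Lemma fop_bounded m (v : 'I_m -> H) X : bounded_operator (fop v X).
Proof. by split; [exact: fop_linear|exact: fop_continuous]. Qed.

Lemma bounded_operatorD (S T : H -> H) : bounded_operator S ->
  bounded_operator T -> bounded_operator (fun x => S x + T x).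
Proof.
move=> [S_lin S_cont] [T_lin T_cont]; split.
  by move=> a x y; rewrite S_lin T_lin scalerDr addrACA.
by move=> x; apply: cvgD; [exact: S_cont|exact: T_cont].
Qed.

End FiniteOperator.

(** * Cholesky factorization of positive operators *)

Section Cholesky.
Context {R : realType} {F : scalar_kind}.
Local Notation K := (scalars R F).
Local Notation conj := (@conj_scalar R F).
Context {H : completeNormedModType K} (dot : {dot H for @conj_scalar R F}).

(** Linear independence of [v] in a usable form: the dual family [w] extracts coefficients and
    provides preimages of the [v k]. *)
Definition biorthogonal m (v w : 'I_m -> H) : Prop :=
  forall k l, dot (w k) (v l) = (k == l)%:R.

Definition cons_family m (a : H) (f : 'I_m -> H) (i : 'I_m.+1) : H :=
  oapp f a (unlift ord0 i).

Lemma cons_family0 m a (f : 'I_m -> H) : cons_family a f ord0 = a.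
Proof. by rewrite /cons_family unlift_none. Qed.

Lemma cons_familyS m a (f : 'I_m -> H) k : cons_family a f (lift ord0 k) = f k.
Proof. by rewrite /cons_family liftK. Qed.

(** Subtracting a multiple of [w0] makes each [w k] orthogonal to [v0], and keeps its products with
    the [v l], to which [w0] is orthogonal. *)
Lemma biorthogonal_cons m (v w : 'I_m -> H) (v0 w0 : H) :
  biorthogonal v w -> dot w0 v0 = 1 -> (forall k, dot w0 (v k) = 0) ->
  biorthogonal (cons_family v0 v)
    (cons_family w0 (fun k => w k - dot (w k) v0 *: w0)).
Proof.
move=> vw w0v0 w0v k l.
case: (unliftP ord0 k) => [i ->|->]; case: (unliftP ord0 l) => [j ->|->];
  rewrite ?cons_familyS ?cons_family0 ?dotBl ?dotZl.
- by rewrite w0v mulr0 subr0 vw (inj_eq lift_inj).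
- by rewrite w0v0 mulr1 subrr.
- by rewrite w0v.
- by rewrite w0v0 eqxx.
Qed.

Lemma fop_id_cons m (v : 'I_m -> H) v0 x :
  fop dot (cons_family v0 v) 1%:M x = fop dot v 1%:M x + dot x v0 *: v0.
Proof.
rewrite !fop_id big_ord_recl cons_family0 addrC; congr (_ + _).
by apply: eq_bigr => k _; rewrite cons_familyS.
Qed.

Lemma fop_id_dual m (v w : 'I_m -> H) k :
  biorthogonal v w -> fop dot v 1%:M (w k) = v k.
Proof.
move=> vw; rewrite fop_id (bigD1 k)//= vw eqxx scale1r big1 ?addr0// => l.
by rewrite eq_sym vw => /negPf ->; rewrite scale0r.
Qed.

Hypothesis dot_norm : forall x : H, dot x x = `|x| ^+ 2.

Lemma positive_linear P : positive_operator dot P -> linear P.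
Proof. by case=> [[]]. Qed.

Lemma positive_sym P : positive_operator dot P ->
  forall x y, dot (P x) y = dot x (P y).
Proof. by case=> _ [_]. Qed.

Lemma positive_ge0 P : positive_operator dot P -> forall x, 0 <= dot x (P x).
Proof. by case. Qed.

Lemma positiveP P : bounded_operator P ->
  (forall x y, dot (P x) y = dot x (P y)) -> (forall x, 0 <= dot x (P x)) ->
  positive_operator dot P.
Proof. by []. Qed.

Lemma scalar_sqrt (c : K) : 0 < c -> exists s : K, [/\ 0 < s, conj s = s & s * s = c].
Proof.
move=> c_gt0; have [r r_ge0 cE] := of_real_ge0 (ltW c_gt0).
exists (of_real F (Num.sqrt r)); split; last 2 first.
- exact: conj_of_real.
- by rewrite -rmorphM -expr2 sqr_sqrtr.
by rewrite -(rmorph0 (@of_real R F)) ltr_of_real sqrtr_gt0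
  -(@ltr_of_real R F) rmorph0 -cE.
Qed.

(* With [s = 1 / sqrt <P u, u>], Cauchy-Schwarz for the form of [P] keeps the
   difference positive. *)
Lemma cholesky_step P u : positive_operator dot P -> dot (P u) u != 0 ->
  exists s : K, let v0 := s *: P u in let P' x := P x - dot x v0 *: v0 in
    [/\ positive_operator dot P', P' u = 0 & dot (s *: u) v0 = 1].
Proof.
move=> P_pos Pu_neq0.
have P_lin := positive_linear P_pos; have P_sym := positive_sym P_pos.
have P_ge0 := positive_ge0 P_pos.
have c_gt0 : 0 < dot (P u) u by rewrite lt_def Pu_neq0 P_sym P_ge0.
have [s [s_gt0 s_real sE]] := scalar_sqrt c_gt0.
have s_neq0 : s != 0 by rewrite gt_eqF.
have sV_real : conj s^-1 = s^-1 by rewrite conjV s_real.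
exists s^-1; set v0 := s^-1 *: P u => /=.
have v0E x : dot x v0 = s^-1 * dot (P x) u by rewrite dotZr sV_real -P_sym.
split.
- apply: positiveP.
  + have -> : (fun x => P x - dot x v0 *: v0) =
        (fun x => P x + fop dot (fun _ : 'I_1 => v0) (const_mx (-1)) x).
      apply/funext => x; congr (_ + _); rewrite /fop !big_ord1 !mxE mulN1r.
      by rewrite scaleNr.
    by apply: bounded_operatorD; [case: P_pos|exact: fop_bounded].
  + move=> x y; rewrite dotBl dotBr [dot (_ *: v0) y]dotZl [dot x (_ *: v0)]dotZr P_sym.
    by rewrite [dot v0 y]dotC mulrC.
  + move=> x; rewrite dotBr [dot x (_ *: v0)]dotZr mulrC mul_conj_scalar subr_ge0 v0E normrM exprMn.
    rewrite -[`|s^-1| ^+ 2]mul_conj_scalar sV_real -invfM sE ler_pdivrMl// mulrC.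
    rewrite -(P_sym x x); exact: positive_cauchy_schwarz.
- by rewrite v0E -sE mulKf// scalerA divff// scale1r subrr.
- by rewrite dotZl v0E -sE mulKf// mulVf.
Qed.

(** Each step of symmetric elimination splits off a rank one operator. Either the remainder vanishes
    and [P] is factored, or [m] steps succeed and leave [m] independent vectors in the range of
    [P]. *)
Lemma cholesky m P : positive_operator dot P ->
  (exists r (v w : 'I_r -> H), biorthogonal v w /\ P = fop dot v 1%:M) \/
  (exists v w : 'I_m -> H, biorthogonal v w /\ forall k, exists u, v k = P u).
Proof.
elim: m P => [|m IH] P P_pos.
  by right; exists (fun=> 0), (fun=> 0); split=> [[]|[]].
have P_lin := positive_linear P_pos; have P_sym := positive_sym P_pos.
(* A vanishing quadratic form means [P = 0]; otherwise some [u] serves as pivot. *)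
have [P0|] := pselect (forall u, dot (P u) u = 0).
  left; exists 0, (fun=> 0), (fun=> 0); split=> [[]//|].
  apply/funext => x; rewrite /fop big_ord0.
  apply: (positive_dot_eq0 P_lin P_sym (positive_ge0 P_pos)); exact: P0.
move=> /existsNP[u /eqP Pu_neq0].
have [s] := cholesky_step P_pos Pu_neq0.
set v0 := s *: P u => /=; set P' := fun x => _ => -[P'_pos P'u w0v0].
have {}P'u : P' u = 0 by [].
(* [P' u = 0] and the symmetry of [P'] make the new dual vector orthogonal to the range of [P'],
   where the other [v k] lie. *)
have orth v (v_range : exists x, v = P' x) : dot (s *: u) v = 0.
  by case: v_range => x ->; rewrite dotZl -(positive_sym P'_pos) P'u dot0l mulr0.
have PE x : P x = P' x + dot x v0 *: v0 by rewrite subrK.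
have [[r [v [w [vw P'E]]]]|[v [w [vw v_range]]]] := IH _ P'_pos.
  left; exists r.+1, (cons_family v0 v), (cons_family (s *: u)
    (fun k => w k - dot (w k) v0 *: (s *: u))); split.
    apply: biorthogonal_cons => // k; apply: orth; exists (w k).
    by rewrite P'E fop_id_dual.
  by apply/funext => x; rewrite PE P'E fop_id_cons.
right; exists (cons_family v0 v), (cons_family (s *: u)
  (fun k => w k - dot (w k) v0 *: (s *: u))); split.
  by apply: biorthogonal_cons => // k; exact/orth/v_range.
move=> k; case: (unliftP ord0 k) => [i ->|->]; last first.
  by exists (s *: u); rewrite cons_family0 (linZ P_lin).
(* As [P (s *: u) = v0], [P] maps this vector to [P' x]. *)
have [x vE] := v_range i; exists (x - dot x v0 *: (s *: u)).
by rewrite cons_familyS vE (linB P_lin) !(linZ P_lin).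
Qed.

End Cholesky.

(** * Rank of Gram matrices of Hermitian matrices *)

(** The dimension over the reals of the space of Hermitian (in the real case symmetric) matrices of
    size [m]. *)
Definition herm_dim (F : scalar_kind) (m : nat) : nat :=
  match F with RealScalars => (m * (1 + m))./2 | ComplexScalars => m ^ 2 end.

(** Used to rule out [m = n + 1]: a Gram matrix of [n] matrices has rank at most [n]. *)
Lemma leq_herm_dim F m : (m <= herm_dim F m)%N.
Proof.
case: F => /=; last by case: m => // m; rewrite expnS leq_pmulr.
rewrite -{1}(doubleK m) half_leq// -muln2.
by case: m => // m; rewrite leq_mul2l.
Qed.

Definition upper_pairs m := finset (fun p : 'I_m * 'I_m => (p.1 <= p.2)%N).

Lemma card_upper m : #|upper_pairs m| = (m * (1 + m))./2.
Proof.
have -> : #|upper_pairs m| = (\sum_(l < m) l.+1)%N.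
  rewrite -sum1_card big_mkcond /=.
  transitivity (\sum_(p : 'I_m * 'I_m) nat_of_bool (p.1 <= p.2)%N)%N.
    apply: eq_bigr => p _. by rewrite finset.in_set; case: leqP.
  rewrite -(pair_bigA _ (fun k l : 'I_m => nat_of_bool (k <= l)%N)) exchange_big /=.
  apply: eq_bigr => l _; rewrite -[RHS]card_ord -sum1_card.
  rewrite (big_ord_widen m (fun=> 1%N) (ltn_ord l)) [RHS]big_mkcond /=.
  by apply: eq_bigr => k _; rewrite ltnS; case: leqP.
rewrite -[LHS]doubleK; congr half; elim: m => [|m IH]; first by rewrite big_ord0.
by rewrite big_ord_recr /= doubleD IH -!mul2n; lia.
Qed.

Section GramRank.
Context {R : realType} {F : scalar_kind}.
Local Notation K := (scalars R F).
Local Notation conj := (@conj_scalar R F).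

Lemma mulmx_conj_eq0 n p (W : 'M[K]_(n, p)) :
  W *m map_mx conj W^T = 0 -> W = 0.
Proof.
move=> W0; apply/matrixP => i j; rewrite mxE.
move/matrixP: W0 => /(_ i i); rewrite !mxE => /eqP.
rewrite psumr_eq0 => [/allP/(_ j)|q _]; rewrite ?mxE.
  by rewrite mem_index_enum mul_conj_scalar expf_eq0/= normr_eq0 => /(_ isT)/eqP.
by rewrite mul_conj_scalar exprn_ge0.
Qed.

(** If x B B^* = 0 then (x B)(x B)^* = 0, hence x B = 0: the two left kernels agree. *)
Lemma mxrank_mulmx_conj n p (B : 'M[K]_(n, p)) :
  \rank (B *m map_mx conj B^T) = \rank B.
Proof.
apply/eqP; rewrite eqn_leq mxrankM_maxl /=.
set M := B *m _.
have : (kermx M <= kermx B)%MS.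
  apply/sub_kermxP/mulmx_conj_eq0.
  rewrite trmx_mul map_mxM -mulmxA [B *m _]mulmxA -/M mulmxA [kermx M *m M]mulmx_ker.
  by rewrite mul0mx.
move/mxrankS; rewrite !mxrank_ker leq_sub2lE ?rank_leq_row//.
Qed.

Section Family.
Variables (n m : nat) (a : 'I_n -> 'M[K]_m).

(** The [a i] flattened into rows. All positions serve the complex case, the upper triangle the real
    case. *)
Definition coordmx (T : {set 'I_m * 'I_m}) : 'M[K]_(n, #|T|) :=
  \matrix_(i, q) a i (enum_val q).1 (enum_val q).2.

Lemma gram_coordmx :
  \matrix_(i, j) \sum_k \sum_l a i k l * conj (a j k l) =
  coordmx [set: _]%SET *m map_mx conj (coordmx [set: _]%SET)^T.
Proof.
apply/matrixP => i j; rewrite !mxE pair_big.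
rewrite (eq_bigl (fun p => p \in [set: 'I_m * 'I_m]%SET)); last first.
  by move=> p; rewrite finset.in_setT.
by rewrite big_enum_val; apply: eq_bigr => q _; rewrite !mxE.
Qed.

(** Full column rank means that the conjugate transpose has a trivial left kernel, and a kernel
    vector is a matrix supported on [T] and orthogonal to all [a i]. *)
Lemma rank_coordmx (T : {set 'I_m * 'I_m}) :
  \rank (coordmx T) = #|T| <->
  forall Y : 'M[K]_m, (forall k l, (k, l) \notin T -> Y k l = 0) ->
    (forall i, \sum_k \sum_l Y k l * conj (a i k l) = 0) -> Y = 0.
Proof.
rewrite -(mxrank_map conj) -mxrank_tr; set B := (map_mx _ _)^T.
have BE q i : B q i = conj (a i (enum_val q).1 (enum_val q).2) by rewrite !mxE.
split=> [rkB Y YT Y_orth|h].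
  have /row_freeP[C BC] : row_free B by rewrite /row_free rkB.
  pose y : 'rV[K]_#|T| := \row_q Y (enum_val q).1 (enum_val q).2.
  have yB : y *m B = 0.
    apply/matrixP => z i; rewrite mxE [RHS]mxE -[RHS](Y_orth i) pair_big/=.
    rewrite [RHS](bigID (mem T)) /= [X in _ + X]big1 ?addr0; last first.
      by case=> k l /YT /= ->; rewrite mul0r.
    by rewrite [RHS]big_enum_val; apply: eq_bigr => q _; rewrite mxE BE.
  have y0 : y = 0 by rewrite -[y]mulmx1 -BC mulmxA yB mul0mx.
  apply/matrixP => k l; rewrite mxE.
  have [klT|/YT//] := boolP ((k, l) \in T).
  move/matrixP: y0 => /(_ 0 (enum_rank_in klT (k, l))).
  by rewrite !mxE enum_rankK_in.
apply/eqP; rewrite -[_ == _]/(row_free B) -kermx_eq0; apply/eqP/row_matrixP => z.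
rewrite row0; set y := row z _.
have yB : y *m B = 0 by rewrite -row_mul mulmx_ker row0.
(* The kernel vector [y] extended by zero: the sum has one term on [T] and none off [T]. *)
pose Y : 'M[K]_m := \matrix_(k, l) \sum_(q | enum_val q == (k, l)) y 0 q.
have Y0 : Y = 0.
  apply: h => [k l klT|i].
    rewrite mxE big1// => q /eqP qkl.
    by have := enum_valP q; rewrite qkl (negPf klT).
  transitivity ((y *m B) 0 i); last by rewrite yB mxE.
  rewrite [RHS]mxE.
  rewrite pair_big/= (eq_bigr (fun p => \sum_(q | enum_val q == p)
      y 0 q * conj (a i (enum_val q).1 (enum_val q).2))).
    rewrite (exchange_big_dep xpredT)//=; apply: eq_bigr => q _.
    by rewrite (big_pred1 (enum_val q)) ?BE// => p; rewrite eq_sym.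
  move=> [k l] _ /=; rewrite mxE mulr_suml; apply: eq_bigr => q /eqP -> //.
apply/matrixP => z' q; rewrite ord1 [RHS]mxE.
move/matrixP: Y0 => /(_ (enum_val q).1 (enum_val q).2).
rewrite mxE [RHS]mxE (big_pred1 q)// => q'.
by rewrite -surjective_pairing (inj_eq enum_val_inj).
Qed.

Hypothesis a_sym : forall i, conj_symmetric (a i).

(** The relation is conjugated and its indices are swapped, [a i] being Hermitian. This lets the
    Hermitian and skew parts of [Y] be treated separately. *)
Lemma orthogonal_adjoint (Y : 'M[K]_m) i :
  \sum_k \sum_l Y k l * conj (a i k l) = 0 ->
  \sum_k \sum_l conj (Y l k) * conj (a i k l) = 0.
Proof.
move=> Y_orth; transitivity (conj 0); last exact: conj0.
rewrite -[in RHS]Y_orth conj_sum exchange_big /=.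
apply: eq_bigr => k _; rewrite conj_sum; apply: eq_bigr => l _.
by rewrite conjM (a_sym i k l).
Qed.

Lemma mxrank_colsub_le n1 p1 p2 (B : 'M[K]_(n1, p1)) (B' : 'M[K]_(n1, p2)) f :
  (forall i q, B' i q = B i (f q)) -> (\rank B' <= \rank B)%N.
Proof.
move=> B'E; have -> : B' = B *m colsub f 1%:M; last exact: mxrankM_maxl.
apply/matrixP => i q; rewrite mxE (bigD1 (f q))//= !mxE eqxx mulr1 B'E.
by rewrite big1 ?addr0// => j /negPf jq; rewrite !mxE jq mulr0.
Qed.

Lemma rank_coordmx_upper : (forall i k l, a i k l = a i l k) ->
  \rank (coordmx [set: _]%SET) = \rank (coordmx (upper_pairs m)).
Proof.
move=> a_tr; apply/eqP; rewrite eqn_leq; apply/andP; split.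
  pose s (p : 'I_m * 'I_m) := if (p.1 <= p.2)%N then p else (p.2, p.1).
  have sT p : s p \in upper_pairs m.
    by rewrite finset.in_set /s; case: (leqP p.1 p.2) => //= /ltnW.
  apply: (@mxrank_colsub_le _ _ _ _ _ (fun q => enum_rank_in (sT (enum_val q))
    (s (enum_val q)))) => i q.
  by rewrite !mxE enum_rankK_in// /s; case: leqP => // _; rewrite a_tr.
apply: (@mxrank_colsub_le _ _ _ _ _ (fun q => enum_rank_in
  (finset.in_setT (enum_val q)) (enum_val q))) => i q.
by rewrite !mxE enum_rankK_in ?finset.in_setT.
Qed.

End Family.
End GramRank.

(** By [rank_coordmx], the rank condition says that no nonzero matrix is orthogonal to the [a i],
    among the upper triangular ones over the reals and among all over the complex numbers. It
    remains to pass between these and Hermitian matrices. *)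
Lemma gram_rank_herm (R : realType) (F : scalar_kind) n m
    (a : 'I_n -> 'M[scalars R F]_m) :
  (forall i, conj_symmetric (a i)) ->
  \rank (\matrix_(i, j) \sum_k \sum_l a i k l * conj_scalar (a j k l))
    = herm_dim F m <->
  forall X, conj_symmetric X ->
    (forall i, \sum_k \sum_l X k l * conj_scalar (a i k l) = 0) -> X = 0.
Proof.
move=> a_sym; rewrite gram_coordmx mxrank_mulmx_conj.
case: F a a_sym => a a_sym; rewrite [herm_dim _ _]/=.
  rewrite rank_coordmx_upper; last by move=> i k l; rewrite (a_sym i l k).
  rewrite -card_upper rank_coordmx; split=> h X.
    move=> X_sym X_orth.
    (* The upper triangular [Y] with X = Y + Y^T, so the diagonal is halved. Both summands have the
       same products with the symmetric [a i]. *)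
    pose Y : 'M[scalars R RealScalars]_m := \matrix_(k, l)
      if (k < l)%N then X k l else if k == l then X k l / 2%:R else 0.
    have XE : X = Y + Y^T.
      apply/matrixP => k l; rewrite !mxE [l == k]eq_sym -val_eqE.
      case: ltngtP => [_|_|]; rewrite ?addr0 ?add0r//.
      by move=> /val_inj ->; field.
    have Y0 : Y = 0.
      apply: h => [k l|i].
        rewrite finset.in_set /= -ltnNge mxE => lk.
        by rewrite ltnNge ltnW// -val_eqE gtn_eqF.
      have := X_orth i; rewrite XE.
      have -> : \sum_k \sum_l (Y + Y^T) k l * conj_scalar (a i k l) =
          (\sum_k \sum_l Y k l * conj_scalar (a i k l)) *+ 2.
        rewrite mulr2n; transitivity
          (\sum_k \sum_l Y k l * conj_scalar (a i k l) +
           \sum_k \sum_l Y l k * conj_scalar (a i k l)).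
          rewrite -big_split; apply: eq_bigr => k _; rewrite -big_split.
          by apply: eq_bigr => l _; rewrite !mxE mulrDl.
        congr (_ + _); rewrite exchange_big; apply: eq_bigr => k _.
        by apply: eq_bigr => l _; rewrite (a_sym i k l).
      by move=> /eqP; rewrite mulrn_eq0 /= => /eqP.
    by rewrite XE Y0 trmx0 addr0.
  (* An upper triangular [X] is symmetrized; X + X^T = 0 then gives [X = 0] entry by entry, the
     diagonal being doubled. *)
  move=> XT X_orth; have X0 : X + X^T = 0.
    apply: h => [k l|i]; first by rewrite !mxE addrC.
    under eq_bigr do under eq_bigr do rewrite !mxE mulrDl.
    under eq_bigr do rewrite big_split.
    rewrite big_split /= X_orth add0r; exact: (orthogonal_adjoint a_sym (X_orth i)).
  apply/matrixP => k l; rewrite mxE.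
  move/matrixP: X0 => /(_ k l); rewrite !mxE.
  case: (ltngtP k l) => [kl|lk _|/val_inj ->].
  - by rewrite (XT l k) ?addr0// finset.in_set /= -ltnNge.
  - by apply: XT; rewrite finset.in_set /= -ltnNge.
  - by rewrite -mulr2n => /eqP; rewrite mulrn_eq0 /= => /eqP.
have -> : (m ^ 2 = #|[set: 'I_m * 'I_m]%SET|)%N.
  by rewrite cardsT card_prod card_ord mulnn.
rewrite rank_coordmx; split=> h X.
  by move=> _; apply: h => k l; rewrite finset.in_setT.
(* With [Xc] the adjoint of [X], the matrices [X + Xc] and [I *: (X - Xc)] are Hermitian and
   orthogonal to the [a i]. Both vanish, hence so does [X]. *)
move=> _ X_orth; pose Xc : 'M[scalars R ComplexScalars]_m :=
  \matrix_(k, l) conj_scalar (X l k).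
have Xc_orth i : \sum_k \sum_l Xc k l * conj_scalar (a i k l) = 0.
  under eq_bigr do under eq_bigr do rewrite mxE.
  exact: orthogonal_adjoint.
have Xp : X + Xc = 0.
  apply: h => [k l|i]; first by rewrite !mxE conjD conj_scalarK addrC.
  under eq_bigr do under eq_bigr do rewrite !mxE mulrDl.
  under eq_bigr do rewrite big_split.
  rewrite big_split /= X_orth add0r -[RHS](Xc_orth i).
  by under [RHS]eq_bigr do under eq_bigr do rewrite mxE.
pose I : scalars R ComplexScalars := 'i%C.
have I_conj : conj_scalar I = - I by apply/eqP; rewrite eq_complex /= oppr0 !eqxx.
have I_neq0 : I != 0 by rewrite eq_complex /= oner_eq0 andbF.
have Xm : I *: (X - Xc) = 0.
  apply: h => [k l|i].
    by rewrite !mxE conjM I_conj conjB conj_scalarK mulNr -mulrN opprB.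
  under eq_bigr do under eq_bigr do rewrite 3!mxE mulrBr mulrBl -!mulrA.
  under eq_bigr do rewrite sumrB -!mulr_sumr.
  by rewrite sumrB -!mulr_sumr X_orth Xc_orth mulr0 subrr.
move/eqP: Xm; rewrite scaler_eq0 (negPf I_neq0) subr_eq0 => /eqP XXc.
move: Xp; rewrite -XXc -mulr2n => /eqP.
by rewrite -scaler_nat scaler_eq0 pnatr_eq0 /= => /eqP.
Qed.

(** * Spectral theorem for Hermitian matrices *)

Section Householder.
Context {R : realType}.

Lemma normalize_row n (u : 'rV[R]_n) : u != 0 ->
  exists2 c : R, c != 0 & (c *: u) *m (c *: u)^T = 1%:M.
Proof.
move=> u_neq0; pose s := (u *m u^T) 0 0.
have sE : s = \sum_j u 0 j ^+ 2.
  by rewrite /s mxE; apply: eq_bigr => j _; rewrite mxE expr2.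
have s_gt0 : 0 < s.
  rewrite lt_def sE sumr_ge0 ?andbT => [|j _]; last exact: sqr_ge0.
  apply: contraNneq u_neq0 => /eqP; rewrite psumr_eq0 => [/allP s0|j _]; last first.
    exact: sqr_ge0.
  apply/eqP/rowP => j; rewrite mxE.
  by move: (s0 j (mem_index_enum _)); rewrite sqrf_eq0 => /eqP.
exists (Num.sqrt s)^-1; first by rewrite invr_eq0 sqrtr_eq0 -ltNge.
rewrite linearZ /= -scalemxAl -scalemxAr scalerA -invfM -expr2 sqr_sqrtr ?ltW//.
by rewrite [u *m _]mx11_scalar -/s scale_scalar_mx mulVf// gt_eqF.
Qed.

(** The reflection that exchanges the first basis vector e_0 and [u]. With w = e_0 - u one has |w|^2
    = 2 w_0, so it is 1 - w^T w / w_0. *)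
Lemma householder n (u : 'rV[R]_n.+1) : u *m u^T = 1%:M ->
  exists2 Q : 'M[R]_n.+1, Q *m Q^T = 1%:M & row 0 Q = u.
Proof.
move=> uu; pose w : 'rV[R]_n.+1 := delta_mx 0 0 - u.
have uuE : \sum_j u 0 j ^+ 2 = 1.
  move/matrixP: uu => /(_ 0 0); rewrite !mxE eqxx mulr1n => <-.
  by apply: eq_bigr => j _; rewrite mxE expr2.
have wE j : w 0 j = (j == 0)%:R - u 0 j by rewrite !mxE eqxx.
clearbody w.
have wwE : \sum_j w 0 j ^+ 2 = 2%:R * w 0 0.
  have -> : \sum_j w 0 j ^+ 2 =
      \sum_(j < n.+1) (j == 0)%:R - \sum_(j < n.+1) (j == 0)%:R * (u 0 j *+ 2) + \sum_j u 0 j ^+ 2.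
    rewrite -sumrB -big_split; apply: eq_bigr => j _ /=; rewrite wE.
    by case: (j == 0); rewrite /=; ring.
  have d0 (f : 'I_n.+1 -> R) : \sum_(j < n.+1) (j == 0)%:R * f j = f 0.
    rewrite (bigD1 0)//= mul1r big1 ?addr0// => j /negPf ->.
    by rewrite mul0r.
  have d1 : \sum_(j < n.+1) (j == 0)%:R = 1 :> R.
    by rewrite -[RHS](d0 (fun=> 1)); apply: eq_bigr => j _; rewrite mulr1.
  by rewrite uuE (d0 (fun j => u 0 j *+ 2)) d1 wE eqxx /=; ring.
(* If w_0 = 0 then w = 0 and [u] is already e_0. *)
have [w0|w0] := eqVneq (w 0 0) 0.
  exists 1%:M; first by rewrite trmx1 mulmx1.
  have /eqP : \sum_j w 0 j ^+ 2 = 0 by rewrite wwE w0 mulr0.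
  rewrite psumr_eq0 => [/allP s0|j _]; last exact: sqr_ge0.
  apply/rowP => j; have := s0 j (mem_index_enum _).
  rewrite /= sqrf_eq0 wE subr_eq0 => /eqP <-.
  by rewrite !mxE eq_sym.
pose Q : 'M[R]_n.+1 := 1%:M - (w 0 0)^-1 *: (w^T *m w).
have QE i j : Q i j = (i == j)%:R - (w 0 0)^-1 * (w 0 i * w 0 j).
  by rewrite !mxE big_ord1 mxE.
clearbody Q; exists Q; last first.
  by apply/rowP => j; rewrite mxE QE mulKf// wE eq_sym; ring.
apply/matrixP => i j; rewrite !mxE.
under eq_bigr do rewrite mxE !QE.
have -> : \sum_k ((i == k)%:R - (w 0 0)^-1 * (w 0 i * w 0 k)) *
    ((j == k)%:R - (w 0 0)^-1 * (w 0 j * w 0 k)) =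
   \sum_k (i == k)%:R * (j == k)%:R
   - (w 0 0)^-1 * (w 0 i * \sum_k (j == k)%:R * w 0 k)
   - (w 0 0)^-1 * (w 0 j * \sum_k (i == k)%:R * w 0 k)
   + (w 0 0)^-1 ^+ 2 * w 0 i * w 0 j * \sum_k w 0 k ^+ 2.
  rewrite !mulr_sumr -!sumrB -big_split; apply: eq_bigr => k _ /=.
  by ring.
have dE a (f : 'I_n.+1 -> R) : \sum_(k < n.+1) (a == k)%:R * f k = f a.
  rewrite (bigD1 a)//= eqxx mul1r big1 ?addr0// => k.
  by rewrite eq_sym => /negPf ->; rewrite mul0r.
by rewrite !dE wwE [j == i]eq_sym; field.
Qed.

(** Over the complex numbers [G] is Hermitian and has a real eigenvalue. This is a root of the
    characteristic polynomial of the real matrix [G], so it has a real eigenvector too. *)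
Lemma real_symmetric_eigen n (G : 'M[R]_n.+1) : G^T = G ->
  exists r (u : 'rV[R]_n.+1), u != 0 /\ u *m G = r *: u.
Proof.
move=> G_sym; pose Gc := map_mx (real_complex R) G.
have Gc_herm : Gc \is hermsymmx.
  apply/is_hermitianmxP; rewrite expr0 scale1r; apply/matrixP => i j.
  by rewrite !mxE -[in LHS]G_sym mxE; exact/esym/conjc_real.
have /orthomx_spectralP GcE := hermitian_normalmx Gc_herm.
have sp_real := hermitian_spectral_diag_real Gc_herm.
set U := spectralmx Gc in GcE; set sp := spectral_diag Gc in GcE sp_real.
have U_unit : U \in unitmx := spectral_unit Gc.
have [r spE] : exists r, sp 0 0 = (real_complex R r).
  by apply/complex_realP; have /mxOverP := sp_real; apply.
have : eigenvalue Gc (sp 0 0).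
  apply/eigenvalueP; exists (row 0 U).
    rewrite -row_mul {1}GcE !mulmxA mulmxV// mul1mx row_mul row_diag_mx.
    by rewrite -scalemxAl -rowE.
  apply: contraTneq U_unit => U0; apply/negP => /mulmxV /(congr1 (row 0)).
  rewrite row_mul U0 mul0mx => /rowP/(_ 0); rewrite !mxE eqxx => /eqP.
  by rewrite eq_sym oner_eq0.
rewrite eigenvalue_root_char /Gc -map_char_poly spE fmorph_root.
rewrite -eigenvalue_root_char => /eigenvalueP[u uG u0].
by exists r, u.
Qed.

(** Deflation: an orthogonal [Q] whose first row is a unit eigenvector turns [G] into a block
    diagonal matrix, and induction applies to the lower block. *)
Lemma real_symmetric_spectral n (G : 'M[R]_n) : G^T = G ->
  exists (U : 'M[R]_n) (mu : 'rV[R]_n),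
    U *m U^T = 1%:M /\ U *m G = diag_mx mu *m U.
Proof.
elim: n G => [|n IH] G G_sym.
  by exists 1%:M, 0; split; apply/matrixP => [[]].
have [r [u [/normalize_row[c c0 uu] uG]]] := real_symmetric_eigen G_sym.
have {}uG : (c *: u) *m G = r *: (c *: u).
  by rewrite -scalemxAl uG !scalerA mulrC.
have [Q QQ Qu] := householder uu.
pose G1 : 'M[R]_(1 + n) := Q *m G *m Q^T.
have G1_sym : G1^T = G1 by rewrite !trmx_mul trmxK G_sym mulmxA.
have G1_row : row 0 G1 = r *: delta_mx 0 0.
  rewrite !row_mul Qu uG -Qu -scalemxAl -row_mul QQ.
  by rewrite row1.
have G1Q : G1 = Q *m G *m Q^T by [].
clearbody G1.
have G1E j : G1 0 j = r * (j == 0)%:R.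
  by move/rowP: G1_row => /(_ j); rewrite !mxE eqxx.
have G1C i j : G1 i j = G1 j i by rewrite -[in LHS]G1_sym mxE.
pose G2 := drsubmx G1.
have G1_block : G1 = block_mx r%:M 0 0 G2.
  rewrite -[LHS]submxK; congr block_mx; apply/matrixP => i j; rewrite !mxE.
  - by rewrite !ord1 (_ : lshift n 0 = 0) ?G1E ?mulr1; last exact: val_inj.
  - by rewrite ord1 (_ : lshift n 0 = 0) ?G1E ?mulr0; last exact: val_inj.
  - by rewrite G1C ord1 (_ : lshift n 0 = 0) ?G1E ?mulr0; last exact: val_inj.
have G2_sym : G2^T = G2 by rewrite /G2 trmx_drsub G1_sym.
have [U2 [mu2 [UU2 UG2]]] := IH _ G2_sym.
pose mu : 'rV[R]_(1 + n) := row_mx (const_mx r) mu2.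
pose B : 'M[R]_(1 + n) := block_mx 1%:M 0 0 U2.
have BB : B *m B^T = 1%:M.
  rewrite tr_block_mx !trmx0 trmx1 mulmx_block !mulmx0 !mul0mx !addr0 add0r.
  by rewrite mulmx1 UU2 -scalar_mx_block.
have BG : B *m G1 = diag_mx mu *m B.
  rewrite G1_block /mu diag_mx_row diag_const_mx !mulmx_block.
  by rewrite !mulmx0 !mul0mx !addr0 !add0r mulmx1 mul1mx UG2.
exists (B *m Q), mu; split.
  by rewrite trmx_mul mulmxA -[B *m Q *m _]mulmxA QQ mulmx1 BB.
by rewrite mulmxA -BG G1Q -!mulmxA (mulmx1C QQ) mulmx1.
Qed.
End Householder.

Lemma hermitian_spectral_mx (R : realType) (F : scalar_kind) m
    (G : 'M[scalars R F]_m) : conj_symmetric G ->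
  exists (U : 'M[scalars R F]_m) (mu : 'I_m -> R),
    U *m map_mx (@conj_scalar R F) U^T = 1%:M /\
    U *m G = diag_mx (\row_i of_real F (mu i)) *m U.
Proof.
case: F G => G G_sym.
  have [|U [mu [UU UG]]] := @real_symmetric_spectral R m G.
    by apply/matrixP => i j; rewrite mxE (G_sym i j).
  exists U, (mu 0); split.
    by rewrite (_ : map_mx _ _ = U^T)//; apply/matrixP => i j; rewrite !mxE.
  by rewrite UG; congr (diag_mx _ *m _); apply/rowP => i; rewrite mxE.
have G_herm : (G : 'M[R[i]]_m) \is hermsymmx.
  apply/is_hermitianmxP; rewrite expr0 scale1r; apply/matrixP => i j.
  by rewrite !mxE; exact: G_sym.
have /orthomx_spectralP GE := hermitian_normalmx G_herm.
have sp_real := hermitian_spectral_diag_real G_herm.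
have U_unitary := spectral_unitarymx (G : 'M[R[i]]_m).
have U_unit := spectral_unit (G : 'M[R[i]]_m).
set U := spectralmx _ in GE U_unitary U_unit.
set sp := spectral_diag _ in GE sp_real.
have /choice[mu muE] : forall i, exists r, sp 0 i = real_complex R r.
  by move=> i; apply/complex_realP; have /mxOverP := sp_real; apply.
exists U, mu; split; first by move/unitarymxP: U_unitary.
rewrite {1}GE !mulmxA mulmxV// mul1mx; congr (diag_mx _ *m _).
by apply/rowP => i; rewrite mxE muE.
Qed.

Lemma hermitian_spectral (R : realType) (F : scalar_kind) m
    (G : 'M[scalars R F]_m) : conj_symmetric G ->
  exists (U : 'M[scalars R F]_m) (mu : 'I_m -> R),
    [/\ forall i j, \sum_l U i l * conj_scalar (U j l) = (i == j)%:R,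
        forall i j, \sum_l conj_scalar (U l i) * U l j = (i == j)%:R &
        forall i j, \sum_l U i l * G l j = of_real F (mu i) * U i j].
Proof.
move=> /hermitian_spectral_mx[U [mu [UU UG]]]; exists U, mu; split=> i j.
- move/matrixP: UU => /(_ i j); rewrite !mxE => <-.
  by apply: eq_bigr => l _; rewrite !mxE.
- move/matrixP: (mulmx1C UU) => /(_ i j); rewrite !mxE => <-.
  by apply: eq_bigr => l _; rewrite !mxE.
- by move/matrixP: UG => /(_ i j); rewrite mul_diag_mx !mxE.
Qed.

(** * Schatten classes under finite rank perturbations *)

Section Schatten.
Context {R : realType} {F : scalar_kind}.
Local Notation K := (scalars R F).
Local Notation conj := (@conj_scalar R F).
Local Notation ofR := (@of_real R F).
Context {H : completeNormedModType K} (dot : {dot H for @conj_scalar R F}).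
Hypothesis dot_norm : forall x : H, dot x x = `|x| ^+ 2.

Lemma precompact_image (f : H -> H) (D : set H) :
  continuous f -> precompact D -> precompact (f @` D).
Proof.
move=> f_cont [U DU [U_compact _]]; exists (f @` U).
  by move=> _ [x Dx <-]; exists x => //; exact: DU.
have fU : compact (f @` U).
  by apply: continuous_compact => //; exact: continuous_subspaceT.
by split=> //; apply: compact_closed => //; exact: norm_hausdorff.
Qed.

(** [N] maps the unit ball into [M] times the unit ball, so the image of the ball lies in [M] times
    a precompact set. *)
Lemma compact_operator_comp (P N : H -> H) (M : K) :
  compact_operator P -> linear N -> (forall x, `|N x| <= M * `|x|) -> 0 < M ->
  compact_operator (P \o N).
Proof.
move=> [[P_lin P_cont] P_compact] N_lin NM M_gt0; split.
  split; first by move=> a x y /=; rewrite N_lin P_lin.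
  move=> x; apply: continuous_comp; last exact: P_cont.
  exact: (lin_bounded_continuous N_lin NM).
apply: (@precompact_subset _ _ ((fun y => M *: y) @`
    (P @` [set x : H | `|x| <= 1]))).
  move=> _ [x /= x1 <-]; exists (P (M^-1 *: N x)).
    exists (M^-1 *: N x) => //=; rewrite normrZ gtr0_norm ?invr_gt0//.
    rewrite ler_pdivrMl// mulr1; apply: le_trans (NM x) _.
    by rewrite ger_pMr.
  by rewrite (linZ P_lin) scalerA mulfV ?scale1r// gt_eqF.
by apply: precompact_image => // x; exact: scaler_continuous.
Qed.

(* As [v k] is in the range of [P], the perturbed operator is [P] composed with a
   bounded operator. *)
Lemma compact_operator_perturb m (P : H -> H) (u v : 'I_m -> H) X :
  compact_operator P -> (forall k, v k = P (u k)) ->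
  compact_operator (fun x => P x + fop dot v X x).
Proof.
move=> P_compact vE; have [[P_lin _] _] := P_compact.
pose N x := x + \sum_k \sum_l (X k l * dot x (v k)) *: u l.
have -> : (fun x => P x + fop dot v X x) = P \o N.
  apply/funext => x /=; rewrite (linD P_lin); congr (_ + _).
  rewrite (lin_sum P_lin); apply: eq_bigr => k _.
  rewrite (lin_sum P_lin); apply: eq_bigr => l _.
  by rewrite (linZ P_lin) -vE.
apply: (@compact_operator_comp _ _ (1 + \sum_k \sum_l `|X k l| * `|v k| * `|u l|)).
- by [].
- move=> a x y; rewrite /N scalerDr addrACA; congr (_ + _).
  rewrite scaler_sumr -big_split; apply: eq_bigr => k _ /=.
  rewrite scaler_sumr -big_split; apply: eq_bigr => l _ /=.
  by rewrite dotDl dotZl mulrDr scalerDl scalerA mulrCA.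
- move=> x; rewrite mulrDl mul1r; apply: le_trans (ler_normD _ _) _.
  rewrite lerD2l mulr_suml; apply: le_trans (ler_norm_sum _ _ _) _.
  apply: ler_sum => k _; rewrite mulr_suml; apply: le_trans (ler_norm_sum _ _ _) _.
  apply: ler_sum => l _; rewrite normrZ normrM mulrAC -!mulrA ler_wpM2l//.
  by rewrite mulrCA ler_wpM2l// mulrC cauchy_schwarz.
- apply: ltr_pwDl => //; apply: sumr_ge0 => k _; apply: sumr_ge0 => l _.
  by rewrite !mulr_ge0.
Qed.

Lemma positive_is_abs P : positive_operator dot P -> is_abs dot P P.
Proof.
by move=> P_pos; split=> //; exists P; split=> //; case: P_pos.
Qed.

(** Here P^2 = B^2, so P^2 x = l^2 x. For l > 0 the vector z = P x - l x satisfies P z = -l z, which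
    positivity of [P] allows only for z = 0; for l = 0, <Px, Px> = 0. *)
Lemma is_abs_eigen P B x (l : R) : positive_operator dot P -> is_abs dot P B ->
  0 <= l -> B x = ofR l *: x -> P x = ofR l *: x.
Proof.
move=> P_pos [B_pos [A' [[_ A'_adj] BB]]] l_ge0 Bx.
have P_lin := positive_linear P_pos; have P_sym := positive_sym P_pos.
have A'E y : A' y = P y.
  by apply: (dot_inj (dot := dot)) => z; rewrite dotC -A'_adj -dotC P_sym.
have PPx : P (P x) = (ofR l * ofR l) *: x.
  rewrite -A'E -[A' (P x)]/((A' \o P) x) -BB /= Bx.
  by rewrite (linZ (positive_linear B_pos)) Bx scalerA.
have [l0|l_neq0] := eqVneq l 0.
  rewrite l0 rmorph0 scale0r; apply: (dot_eq0 (dot := dot)).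
  by rewrite -P_sym PPx l0 rmorph0 mul0r scale0r dot0l.
apply/eqP; rewrite -subr_eq0; set z := _ - _.
have Pz : P z = - (ofR l) *: z.
  rewrite (linB P_lin) (linZ P_lin) PPx /z scalerBr scalerA scaleNr mulNr.
  by rewrite scaleNr opprK addrC.
have := positive_ge0 P_pos z; rewrite -P_sym Pz dotZl mulNr oppr_ge0.
rewrite pmulr_rle0; last first.
  by rewrite -(rmorph0 ofR) ltr_of_real lt_def l_neq0.
move=> zz; apply/eqP/(dot_eq0 (dot := dot))/eqP.
by rewrite eq_le zz dot_ge0.
Qed.

Lemma fop_diag m (v : 'I_m -> H) (d : 'I_m -> K) x :
  fop dot v (diag_mx (\row_k d k)) x = \sum_k (d k * dot x (v k)) *: v k.
Proof.
apply: eq_bigr => k _; rewrite (bigD1 k)//= !mxE eqxx mulr1n big1 ?addr0//.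
by move=> l /negPf lk; rewrite !mxE eq_sym lk mulr0n mul0r scale0r.
Qed.

Lemma fop_out m (v : 'I_m -> H) X x :
  (forall k, dot x (v k) = 0) -> fop dot v X x = 0.
Proof.
by move=> xv; rewrite /fop big1// => k _; rewrite big1// => j _;
  rewrite xv mulr0 scale0r.
Qed.

(** * Rotating finitely many vectors of an orthonormal basis *)

Section Rotation.
Variables (e : nat -> H) (e_onb : orthonormal_basis dot e).
Variables (m : nat) (s : 'I_m -> nat) (s_inj : injective s).
Hypothesis es_neq0 : forall k, e (s k) != 0.
Local Notation es k := (e (s k)).

Lemma onb_sub k l : dot (es k) (es l) = (k == l)%:R.
Proof.
case: e_onb => e_ortho e_norm _.
have [->|kl] := eqVneq k l; last by rewrite e_ortho// (inj_eq s_inj).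
rewrite dot_norm; case: (e_norm (s l)) => [e0|->]; last by rewrite expr1n.
by have := es_neq0 l; rewrite e0 eqxx.
Qed.

Lemma dot_onb_comb (a : 'I_m -> K) l : dot (\sum_k a k *: es k) (es l) = a l.
Proof.
rewrite dot_suml (bigD1 l)//= dotZl onb_sub eqxx mulr1 big1 ?addr0// => k.
by move=> /negPf kl; rewrite dotZl onb_sub kl mulr0.
Qed.

Lemma dot_onb_out k i : (forall l, s l != i) -> dot (es k) (e i) = 0.
Proof. by move=> si; case: e_onb => -> //. Qed.

Variables (U : 'M[K]_m).
Hypothesis UU : forall i j, \sum_l U i l * conj (U j l) = (i == j)%:R.
Hypothesis UU' : forall i j, \sum_l conj (U l i) * U l j = (i == j)%:R.

Definition rotated (k : 'I_m) : H := \sum_l U k l *: es l.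

Definition rotated_basis (i : nat) : H :=
  oapp rotated (e i) [pick k | s k == i].

Lemma rotated_basis_in k : rotated_basis (s k) = rotated k.
Proof.
rewrite /rotated_basis; case: pickP => [k' /eqP/s_inj -> //|/(_ k)].
by rewrite eqxx.
Qed.

Lemma rotated_basis_out i : (forall k, s k != i) -> rotated_basis i = e i.
Proof.
by move=> si; rewrite /rotated_basis; case: pickP => // k; rewrite (negPf (si k)).
Qed.

Lemma rotated_basis_case i : (exists k, i = s k) \/ (forall k, s k != i).
Proof.
have [k /eqP <-|si] := pickP [pred k | s k == i]; first by left; exists k.
by right=> k; rewrite -[_ == _]/([pred k | s k == i] k) si.
Qed.

Lemma dot_rotated k l : dot (rotated k) (rotated l) = (k == l)%:R.
Proof.
rewrite -UU {2}/rotated dot_sumr; apply: eq_bigr => j _.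
by rewrite dotZr dot_onb_comb mulrC.
Qed.

Lemma dot_rotated_out k i : (forall l, s l != i) -> dot (rotated k) (e i) = 0.
Proof.
move=> si; rewrite dot_suml big1// => l _.
by rewrite dotZl dot_onb_out// mulr0.
Qed.

Lemma rotated_inv j : es j = \sum_k conj (U k j) *: rotated k.
Proof.
under eq_bigr do rewrite /rotated scaler_sumr.
rewrite exchange_big /= (bigD1 j)//=.
under eq_bigr do rewrite scalerA.
rewrite -scaler_suml UU' eqxx scale1r big1 ?addr0// => l lj.
under eq_bigr do rewrite scalerA.
by rewrite -scaler_suml UU' eq_sym (negPf lj) scale0r.
Qed.

(** Totality holds because, [U] being unitary, each [e (s j)] is a combination of the rotated
    vectors. *)
Lemma rotated_basis_onb : orthonormal_basis dot rotated_basis.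
Proof.
have [e_ortho e_norm e_total] := e_onb; split.
- move=> i j.
  have [[k ->]|si] := rotated_basis_case i;
    have [[l ->]|sj] := rotated_basis_case j; move=> ij.
  + by rewrite !rotated_basis_in dot_rotated -(inj_eq s_inj) (negPf ij).
  + by rewrite rotated_basis_in (rotated_basis_out sj) dot_rotated_out.
  + by rewrite rotated_basis_in (rotated_basis_out si) dotC dot_rotated_out ?conj0.
  + by rewrite (rotated_basis_out si) (rotated_basis_out sj) e_ortho.
- move=> i; have [[k ->]|si] := rotated_basis_case i; last first.
    by rewrite rotated_basis_out.
  right; apply: (normr_dot dot_norm) => //.
  by rewrite rotated_basis_in dot_rotated eqxx expr1n.
- move=> x x_orth; apply: e_total => i.
  have [[j ->]|si] := rotated_basis_case i; last first.
    by rewrite -(rotated_basis_out si).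
  rewrite rotated_inv dot_sumr big1// => k _.
  by rewrite dotZr -rotated_basis_in x_orth mulr0.
Qed.

End Rotation.

(** [Q] preserves the span of the [e (s k)] and agrees with [P] on the other basis vectors.
    Diagonalizing it on this span gives an eigenbasis of [Q], and its power differs from [T] by a
    finite rank operator, which has a trace. *)
Lemma schatten_perturb (q : R) (P B T : H -> H) (t : K) (e : nat -> H)
    (l : nat -> R) m (s : 'I_m -> nat) (c : 'I_m -> K) (X : 'M[K]_m) :
  let Q x := P x + fop dot (fun k => c k *: e (s k)) X x in
  positive_operator dot P -> is_abs dot P B -> orthonormal_basis dot e ->
  (forall i, 0 <= l i) -> (forall i, B (e i) = ofR (l i) *: e i) ->
  bounded_operator T -> (forall i, T (e i) = ofR (l i `^ q) *: e i) ->
  has_trace dot T t -> injective s -> (forall k, e (s k) != 0) ->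
  positive_operator dot Q -> compact_operator Q ->
  schatten dot q%:E Q.
Proof.
move=> Q P_pos PB e_onb l_ge0 Be T_bd Te Tt s_inj es_neq0 Q_pos Q_compact.
split=> //.
have Q_lin := positive_linear Q_pos.
have Pe i : P (e i) = ofR (l i) *: e i by apply: (is_abs_eigen P_pos PB).
pose G : 'M[K]_m := \matrix_(k, j) dot (Q (e (s k))) (e (s j)).
have G_sym : conj_symmetric G.
  by move=> k j; rewrite !mxE (positive_sym Q_pos) dotC.
have esE := onb_sub e_onb s_inj es_neq0.
have QE k : Q (e (s k)) = \sum_j G k j *: e (s j).
  have [a QaE] : exists a, Q (e (s k)) = \sum_j a j *: e (s j).
    exists (fun j => ofR (l (s k)) * (k == j)%:R +
      \sum_i (X i j * dot (e (s k)) (c i *: e (s i))) * c j).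
    under eq_bigr do rewrite scalerDl; rewrite big_split /=; congr (_ + _).
      rewrite Pe (bigD1 k)//= eqxx mulr1 big1 ?addr0// => j.
      by rewrite eq_sym => /negPf ->; rewrite mulr0 scale0r.
    rewrite /fop exchange_big; apply: eq_bigr => j _; rewrite scaler_suml.
    by apply: eq_bigr => i _; rewrite scalerA.
  rewrite QaE; apply: eq_bigr => j _.
  by rewrite mxE QaE (dot_onb_comb e_onb s_inj es_neq0).
clearbody G.
have [U [mu [UU UU' UG]]] := hermitian_spectral G_sym.
pose f := rotated e s U.
have ff := dot_rotated e_onb s_inj es_neq0 UU.
have Qf k : Q (f k) = ofR (mu k) *: f k.
  rewrite (lin_sum Q_lin) scaler_sumr.
  under eq_bigr do rewrite (linZ Q_lin) QE scaler_sumr.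
  rewrite exchange_big; apply: eq_bigr => j _ /=.
  by rewrite scalerA -UG scaler_suml; apply: eq_bigr => i _; rewrite scalerA.
have mu_ge0 k : 0 <= mu k.
  have := positive_ge0 Q_pos (f k).
  rewrite -(positive_sym Q_pos) Qf dotZl ff eqxx mulr1.
  by rewrite -(rmorph0 ofR) ler_of_real.
pose l' i := oapp mu (l i) [pick k | s k == i].
have l'_in k : l' (s k) = mu k.
  rewrite /l'; case: pickP => [k' /eqP/s_inj -> //|/(_ k)].
  by rewrite eqxx.
have l'_out i : (forall k, s k != i) -> l' i = l i.
  by move=> si; rewrite /l'; case: pickP => // k; rewrite (negPf (si k)).
(* The power of [Q]: the rotated vectors get their new eigenvalues, and the old contribution of the
   [e (s k)] to [T] is removed. *)
pose T' x := T x + (fop dot f (diag_mx (\row_k ofR (mu k `^ q))) x +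
  fop dot (fun k => e (s k)) (diag_mx (\row_k - ofR (l (s k) `^ q))) x).
have T_lin : linear T by case: T_bd.
exists Q, T'; split; first exact: positive_is_abs.
  split; first by do 2!apply: bounded_operatorD => //; exact: fop_bounded.
  exists (rotated_basis e s U), l'; split.
  - exact: (rotated_basis_onb e_onb).
  - move=> i; have [[k ->]|si] := rotated_basis_case s i; first by rewrite l'_in.
    by rewrite l'_out.
  - move=> i; have [[k ->]|si] := rotated_basis_case s i.
      by rewrite l'_in rotated_basis_in.
    rewrite l'_out// rotated_basis_out// /Q Pe fop_out ?addr0// => k.
    by rewrite dotZr [dot (e i) _]dotC (dot_onb_out e_onb)// conj0 mulr0.
  - move=> i; have [[k ->]|si] := rotated_basis_case s i.
      rewrite l'_in rotated_basis_in// /T' !fop_diag.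
      rewrite [X in _ + (X + _)](bigD1 k)//= ff eqxx mulr1.
      rewrite [X in _ + (_ + X + _)]big1 ?addr0 => [|j /negPf jk]; last first.
        by rewrite ff eq_sym jk mulr0 scale0r.
      (* What remains is [T] at a rotated vector, cancelled by the second correction. *)
      rewrite addrCA -[RHS]addr0; congr (_ + _).
      rewrite (lin_sum T_lin) -big_split big1// => j _ /=.
      rewrite (dot_onb_comb e_onb s_inj es_neq0) (linZ T_lin) Te scalerA -scalerDl.
      by rewrite mulNr mulrC subrr scale0r.
    rewrite l'_out// rotated_basis_out// /T' Te !fop_out ?addr0// => k.
      by rewrite dotC (dot_onb_out e_onb)// conj0.
    by rewrite dotC (dot_rotated_out e_onb)// conj0.
eexists; apply: has_traceD; first exact: Tt.
by apply: has_traceD; apply: (has_trace_fop (A := id)).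
Qed.
End Schatten.

(** * Ranks and perturbations *)

(** A duplicate-free list of elements of [I] is extended until it has [n] entries or contains all of
    [I]. *)
Lemma pred_nat_dichotomy (I : pred nat) n :
  (exists s : 'I_n -> nat, injective s /\ forall k, I (s k)) \/
  (exists r (s : 'I_r -> nat), [/\ injective s, forall k, I (s k) &
     forall i, I i -> exists k, i = s k]).
Proof.
pose ind (t : seq nat) (k : 'I_(size t)) := nth 0 t k.
have ind_inj t : uniq t -> injective (ind t).
  by move=> t_uniq k l /eqP; rewrite nth_uniq// => /eqP/val_inj.
have : (exists t, [/\ uniq t, all I t & size t = n]) \/
    (exists t, [/\ uniq t, all I t & forall i, I i -> i \in t]).
  elim: n => [|n [[t [t_uniq tI t_size]]|]]; [by left; exists [::]| |by right].
  have [h|] := pselect (forall i, I i -> i \in t); first by right; exists t.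
  move=> /existsNP[i /not_implyP[Ii /negP it]]; left; exists (i :: t).
  by split; rewrite /= ?it ?Ii ?t_size.
case=> [[t [t_uniq /allP tI <-]]|[t [t_uniq /allP tI It]]]; [left|right].
  by exists (ind t); split=> [|k]; [exact: ind_inj|apply/tI/mem_nth].
exists (size t), (ind t); split=> [|k|i /It it]; first exact: ind_inj.
  exact/tI/mem_nth.
rewrite -index_mem in it; exists (Ordinal it).
by rewrite /ind /= nth_index// -index_mem.
Qed.

Section Rank.
Context {R : realType} {F : scalar_kind}.
Local Notation K := (scalars R F).
Context {H : completeNormedModType K} (dot : {dot H for @conj_scalar R F}).

(** A left kernel vector of the coefficient matrix [C] is a relation between the [b i], so [C] has
    rank [r], which is at most its number of columns. *)
Lemma free_leq_span r r' (b : 'I_r -> H) (b' : 'I_r' -> H) :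
  (forall c : 'I_r -> K, \sum_i c i *: b i = 0 -> forall i, c i = 0) ->
  (forall i, exists c : 'I_r' -> K, b i = \sum_j c j *: b' j) -> (r <= r')%N.
Proof.
move=> b_free /choice[c bE]; pose C : 'M[K]_(r, r') := \matrix_(i, j) c i j.
suff : row_free C by move=> /eqP <-; exact: rank_leq_col.
rewrite -kermx_eq0; apply/eqP/row_matrixP => k; rewrite row0.
set x := row k _; have xC : x *m C = 0 by rewrite -row_mul mulmx_ker row0.
apply/rowP => i; rewrite [RHS]mxE; apply: (b_free (x 0)).
under eq_bigr do rewrite bE scaler_sumr.
rewrite exchange_big big1// => j _.
under eq_bigr do rewrite scalerA.
rewrite -scaler_suml; move/matrixP: xC => /(_ 0 j); rewrite mxE [RHS]mxE.
by under eq_bigr do rewrite [C _ _]mxE; move=> ->; rewrite scale0r.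
Qed.

Lemma biorthogonal_free m (v w : 'I_m -> H) : biorthogonal dot v w ->
  forall c : 'I_m -> K, \sum_i c i *: v i = 0 -> forall i, c i = 0.
Proof.
move=> vw c cv i; have : dot (\sum_i c i *: v i) (w i) = 0 by rewrite cv dot0l.
rewrite dot_suml (bigD1 i)//= dotZl [dot (v i) _]dotC vw eqxx rmorph1 mulr1.
rewrite big1 ?addr0// => j /negPf ji.
by rewrite dotZl dotC vw eq_sym ji conj0 mulr0.
Qed.

Lemma has_rank_range (T : H -> H) r (b : 'I_r -> H) i :
  range T = range (fun c : 'I_r -> K => \sum_i c i *: b i) -> exists x, b i = T x.
Proof.
move=> TE; have : range T (b i).
  rewrite TE; exists (fun j => (j == i)%:R) => //.
  rewrite (bigD1 i)//= eqxx scale1r big1 ?addr0// => j /negPf ->.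
  by rewrite scale0r.
by case=> x _ <-; exists x.
Qed.

Lemma free_range_leq_rank (T : H -> H) r m (v : 'I_m -> H) : has_rank T r ->
  (forall c : 'I_m -> K, \sum_i c i *: v i = 0 -> forall i, c i = 0) ->
  (forall k, exists x, v k = T x) -> (m <= r)%N.
Proof.
move=> [b [b_free TE]] v_free vT; apply: (free_leq_span v_free (b' := b)) => k.
have [x ->] := vT k; have : range T (T x) by exists x.
by rewrite TE => -[c _ <-]; exists c.
Qed.

Lemma op_rank_unique (T : H -> H) r : has_rank T r -> op_rank T = r.
Proof.
move=> Tr; apply: xget_unique => // r' Tr'; apply/eqP; rewrite eqn_leq.
have [b [b_free TE]] := Tr; have [b' [b'_free TE']] := Tr'.
rewrite (free_range_leq_rank Tr b'_free) ?(free_range_leq_rank Tr' b_free)//.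
  by move=> k; exact: has_rank_range TE.
by move=> k; exact: has_rank_range TE'.
Qed.

Lemma fop_has_rank m (v w : 'I_m -> H) :
  biorthogonal dot v w -> has_rank (fop dot v 1%:M) m.
Proof.
move=> vw; exists v; split; first exact: biorthogonal_free vw.
apply/seteqP; split=> _ [x _ <-].
  by exists (fun k => dot x (v k)) => //; rewrite fop_id.
exists (\sum_k x k *: w k) => //; rewrite (lin_sum (fop_linear _ _ _)).
by apply: eq_bigr => k _; rewrite (linZ (fop_linear _ _ _)) (fop_id_dual _ vw).
Qed.

End Rank.

(** * Families of vectors that allow small perturbations *)

Section Extreme.
Context {R : realType} {F : scalar_kind}.
Local Notation K := (scalars R F).
Local Notation conj := (@conj_scalar R F).
Local Notation ofR := (@of_real R F).
Context {H : completeNormedModType K} (dot : {dot H for @conj_scalar R F}).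
Hypothesis dot_norm : forall x : H, dot x x = `|x| ^+ 2.

Lemma conj_fixed_real (z : K) : conj z = z -> z \is Num.real.
Proof.
move=> /of_realP[r ->]; rewrite realE -(rmorph0 ofR) !ler_of_real.
exact: le_total.
Qed.

(** Since [v k = P (u k)], Cauchy-Schwarz for the form of [P] bounds |<x, v_k>|^2 by <Px, x><Pu_k,
    u_k>. The bound on [X] then keeps the perturbation below <Px, x> in absolute value. *)
Lemma positive_perturb m (P : H -> H) (u v : 'I_m -> H) (X : 'M[K]_m) :
  positive_operator dot P -> (forall k, v k = P (u k)) -> conj_symmetric X ->
  ((\sum_k \sum_l `|X k l|) * (\sum_k dot (P (u k)) (u k)) : K) <= 1 ->
  positive_operator dot (fun x => P x + fop dot v X x).
Proof.
move=> P_pos vE X_sym small.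
have P_lin := positive_linear P_pos; have P_sym := positive_sym P_pos.
have P_ge0 := positive_ge0 P_pos.
apply: positiveP.
- by apply: bounded_operatorD; [case: P_pos|exact: fop_bounded].
- by move=> x y; rewrite dotDl dotDr P_sym fop_sym.
move=> x; rewrite dotDr -P_sym -fop_sym//; set z := dot (fop _ _ _ _) x.
have z_real : z \is Num.real.
  by apply: conj_fixed_real; rewrite /z -dotC fop_sym.
set p := dot (P x) x.
have p_ge0 : 0 <= p by rewrite /p P_sym.
set al := \sum_k dot (P (u k)) (u k) in small *.
have al_k k : dot (P (u k)) (u k) <= al.
  rewrite /al (bigD1 k)//= lerDl sumr_ge0// => l _.
  by rewrite P_sym.
have xv k : `|dot x (v k)| ^+ 2 <= p * al.
  rewrite vE -P_sym.
  apply: (@le_trans _ _ (p * dot (P (u k)) (u k))).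
    exact: positive_cauchy_schwarz.
  by rewrite ler_wpM2l.
have xvv k l : `|dot x (v k) * dot (v l) x| <= p * al.
  rewrite normrM [dot (v l) x]dotC normr_conj_scalar.
  set a := `|dot x (v k)|; set b := `|dot x (v l)|.
  have ab : 0 <= (a - b) ^+ 2.
    by rewrite -realEsqr realB// normr_real.
  have h : (a * b) *+ 2 <= (p * al) *+ 2.
    have h1 : (a * b) *+ 2 <= a ^+ 2 + b ^+ 2.
      by rewrite -subr_ge0 (_ : _ - _ = (a - b) ^+ 2)//; ring.
    exact: le_trans h1 (lerD (xv k) (xv l)).
  by rewrite lerMn2r in h.
have : `|z| <= p.
  rewrite /z dot_fopl; apply: le_trans (ler_norm_sum _ _ _) _.
  apply: (@le_trans _ _ ((\sum_k \sum_l `|X k l|) * (p * al))).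
    rewrite mulr_suml; apply: ler_sum => k _; apply: le_trans (ler_norm_sum _ _ _) _.
    rewrite mulr_suml; apply: ler_sum => l _.
    by rewrite -mulrA normrM ler_wpM2l.
  by rewrite mulrCA -[leRHS]mulr1 ler_wpM2l.
by rewrite real_ler_norml// -/p => /andP[+ _]; rewrite -subr_ge0 opprK addrC.
Qed.

(** What the perturbation argument asks of [v]. Schatten membership is demanded only of positive
    perturbations, which are their own absolute values. *)
Definition perturbable (q : \bar R) (P : H -> H) m (v : 'I_m -> H) : Prop :=
  [/\ exists w, biorthogonal dot v w, forall k, exists u, v k = P u &
      forall X, conj_symmetric X ->
        positive_operator dot (fun x => P x + fop dot v X x) ->
        schatten dot q (fun x => P x + fop dot v X x)].

Lemma perturbable_compact m (P : H -> H) (v w : 'I_m -> H) :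
  compact_operator P -> biorthogonal dot v w -> (forall k, exists u, v k = P u) ->
  perturbable +oo P v.
Proof.
move=> P_compact vw v_range; split=> //; first by exists w.
have [u vE] := choice v_range.
by move=> X _ _; exact: compact_operator_perturb.
Qed.

(** The square roots make the sum of the <., v_k> v_k equal to [P] when [s] lists all nonzero
    eigenvalues, as [fop_eigen] shows. *)
Lemma perturbable_eigen (q : R) (P B T : H -> H) (t : K) (e : nat -> H)
    (l : nat -> R) m (s : 'I_m -> nat) :
  positive_operator dot P -> compact_operator P -> is_abs dot P B ->
  orthonormal_basis dot e ->
  (forall i, 0 <= l i) -> (forall i, B (e i) = ofR (l i) *: e i) ->
  bounded_operator T -> (forall i, T (e i) = ofR (l i `^ q) *: e i) ->
  has_trace dot T t -> injective s ->
  (forall k, (e (s k) != 0) && (l (s k) != 0)) ->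
  perturbable q%:E P (fun k => ofR (Num.sqrt (l (s k))) *: e (s k)).
Proof.
move=> P_pos P_compact PB e_onb l_ge0 Be T_bd Te Tt s_inj es.
have P_lin := positive_linear P_pos.
have es_neq0 k : e (s k) != 0 by case/andP: (es k).
have l_gt0 k : 0 < l (s k) by case/andP: (es k) => _ lk; rewrite lt_def lk l_ge0.
have c_neq0 k : ofR (Num.sqrt (l (s k))) != 0.
  by rewrite fmorph_eq0 sqrtr_eq0 -ltNge.
have v_range k : exists u, ofR (Num.sqrt (l (s k))) *: e (s k) = P u.
  exists (ofR (Num.sqrt (l (s k)) / l (s k)) *: e (s k)).
  rewrite (linZ P_lin) (is_abs_eigen P_pos PB (l_ge0 _) (Be _)) scalerA -rmorphM.
  by rewrite divfK// gt_eqF.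
split=> //.
  exists (fun k => (ofR (Num.sqrt (l (s k))))^-1 *: e (s k)) => k k'.
  rewrite dotZl dotZr conj_of_real (onb_sub dot_norm e_onb s_inj es_neq0).
  have [->|_] := eqVneq k k'; first by rewrite mulr1 mulVf.
  by rewrite !mulr0.
move=> X X_sym Q_pos; have [u vE] := choice v_range.
by apply: (schatten_perturb dot_norm P_pos PB e_onb l_ge0 Be T_bd Te Tt s_inj es_neq0 Q_pos);
  exact: compact_operator_perturb.
Qed.

Lemma fop_eigen (P : H -> H) (e : nat -> H) (l : nat -> R) m (s : 'I_m -> nat) :
  positive_operator dot P -> orthonormal_basis dot e -> (forall i, 0 <= l i) ->
  (forall i, P (e i) = ofR (l i) *: e i) -> injective s ->
  (forall k, (e (s k) != 0) && (l (s k) != 0)) ->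
  (forall i, (e i != 0) && (l i != 0) -> exists k, i = s k) ->
  P = fop dot (fun k => ofR (Num.sqrt (l (s k))) *: e (s k)) 1%:M.
Proof.
move=> P_pos e_onb l_ge0 Pe s_inj es s_all; apply/funext => x; rewrite fop_id.
have es_neq0 k : e (s k) != 0 by case/andP: (es k).
have [_ _ e_total] := e_onb; apply/eqP; rewrite -subr_eq0; apply/eqP/e_total => i.
rewrite dotBl (positive_sym P_pos) Pe dotZr conj_of_real dot_suml.
have sqrtE k : ofR (Num.sqrt (l (s k))) * ofR (Num.sqrt (l (s k))) = ofR (l (s k)).
  by rewrite -rmorphM -expr2 sqr_sqrtr.
have [/s_all[k ->]|ei] := boolP ((e i != 0) && (l i != 0)).
  rewrite (bigD1 k)//= !(dotZl, dotZr) conj_of_real.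
  rewrite (onb_sub dot_norm e_onb s_inj es_neq0) eqxx mulr1 big1 => [|j /negPf jk]; last first.
    by rewrite !dotZl (onb_sub dot_norm e_onb s_inj es_neq0) jk !mulr0.
  by rewrite addr0 mulrAC sqrtE subrr.
rewrite big1 ?subr0 => [|k _]; last first.
  rewrite !dotZl; have [e0|e_neq0] := eqVneq (e i) 0; first by rewrite e0 dot0r !mulr0.
  rewrite (dot_onb_out e_onb) ?mulr0// => j.
  by apply: contraNneq ei => <-; exact: es.
by move: ei; rewrite negb_and !negbK => /orP[]/eqP ->; rewrite ?dot0r ?mulr0 ?rmorph0 ?mul0r.
Qed.

(** For q = +oo compactness survives every such perturbation in the range of [P], so the Cholesky
    vectors serve. For finite [q] the vectors come from the eigenbasis contained in the Schatten
    condition. *)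
Lemma perturbable_exists q (P : H -> H) n :
  positive_operator dot P -> schatten dot q P ->
  (exists v : 'I_n -> H, perturbable q P v) \/
  (exists r (v : 'I_r -> H), perturbable q P v /\ P = fop dot v 1%:M).
Proof.
move=> P_pos; case: q => [q||//] /=; last first.
  move=> P_compact; have [[r [v [w [vw PE]]]]|[v [w [vw v_range]]]] :=
    cholesky dot_norm n P_pos.
    right; exists r, v; split=> //; apply: (perturbable_compact P_compact vw).
    by move=> k; exists (w k); rewrite PE (fop_id_dual _ vw).
  by left; exists v; apply: (perturbable_compact P_compact vw).
move=> [P_compact [B [T [PB [T_bd [e [l [e_onb l_ge0 Be Te]]]] [t Tt]]]]].
have [[s [s_inj es]]|[r [s [s_inj es s_all]]]] :=
  pred_nat_dichotomy (fun i => (e i != 0) && (l i != 0)) n.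
  left; eexists.
  exact: (perturbable_eigen P_pos P_compact PB e_onb l_ge0 Be T_bd Te Tt s_inj es).
right; exists r; eexists; split.
  exact: (perturbable_eigen P_pos P_compact PB e_onb l_ge0 Be T_bd Te Tt s_inj es).
apply: (fop_eigen P_pos e_onb l_ge0 _ s_inj es s_all) => i.
exact: (is_abs_eigen P_pos PB).
Qed.

End Extreme.

(** * Extreme points *)

Section ExtremePoint.
Context {R : realType} {F : scalar_kind}.
Local Notation K := (scalars R F).
Local Notation conj := (@conj_scalar R F).
Context {H : completeNormedModType K} (dot : {dot H for @conj_scalar R F}).
Hypothesis dot_norm : forall x : H, dot x x = `|x| ^+ 2.
Variables (n : nat) (A : 'I_n -> H -> H).
Hypothesis A_sym : forall j x y, dot (A j x) y = dot x (A j y).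

Definition compression m (v : 'I_m -> H) (j : 'I_n) : 'M[K]_m :=
  \matrix_(k, l) dot (A j (v k)) (v l).

Lemma compression_sym m (v : 'I_m -> H) j : conj_symmetric (compression v j).
Proof. by move=> k l; rewrite !mxE A_sym dotC. Qed.

Lemma has_trace_fop_compression m (v : 'I_m -> H) X j :
  has_trace dot (fop dot v X \o A j)
    (\sum_k \sum_l X k l * conj (compression v j k l)).
Proof.
have -> : \sum_k \sum_l X k l * conj (compression v j k l) =
    \sum_k \sum_l X k l * dot (v l) (A j (v k)).
  by apply: eq_bigr => k _; apply: eq_bigr => l _; rewrite mxE -dotC.
by apply: has_trace_fop => // x y; exact: A_sym.
Qed.

Hypothesis A_lin : forall j, linear (A j).
Variables (e : nat -> H) (e_onb : orthonormal_basis dot e).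

(** The compression of A_i is the matrix of P A_i P in the family [v]. *)
Lemma trace_gram m (v : 'I_m -> H) i j (P := fop dot v 1%:M) :
  trace dot (P \o A i \o P \o A j) =
  \sum_k \sum_l compression v i k l * conj (compression v j k l).
Proof.
apply: (trace_unique e_onb).
have -> : P \o A i \o P \o A j = fop dot v (compression v i) \o A j.
  apply/funext => x /=; rewrite {2}/P fop_id (lin_sum (A_lin i)).
  rewrite /P (lin_sum (fop_linear _ _ _)); apply: eq_bigr => k _.
  rewrite (linZ (A_lin i)) (linZ (fop_linear _ _ _)) fop_id scaler_sumr.
  by apply: eq_bigr => l _; rewrite scalerA mxE mulrC.
exact: has_trace_fop_compression.
Qed.

(* [P \o A j] is not shown to have a trace: if it has none, neither has the perturbed
   product, and both [trace]s are the same default value. *)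
Lemma feasible_perturb q (beta : 'I_n -> K) (P : H -> H) m (v : 'I_m -> H) X :
  feasible_set dot q A beta P -> perturbable dot q P v -> conj_symmetric X ->
  (forall j, \sum_k \sum_l X k l * conj (compression v j k l) = 0) ->
  positive_operator dot (fun x => P x + fop dot v X x) ->
  feasible_set dot q A beta (fun x => P x + fop dot v X x).
Proof.
move=> [P_pos P_schatten P_beta] [_ _ v_schatten] X_sym X_orth Q_pos.
split=> // [|j]; first exact: v_schatten.
rewrite -P_beta; apply: has_trace_eq => t; split=> ht.
  have -> : P \o A j =
      fun x => ((fun x => P x + fop dot v X x) \o A j) x +
        (fop dot v ((-1) *: X) \o A j) x.
    by apply/funext => x /=; rewrite fopZ scaleN1r addrK.
  rewrite -[t]addr0; apply: has_traceD => //.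
  have := @has_trace_fop_compression m v ((-1) *: X) j; congr has_trace.
  under eq_bigr do under eq_bigr do rewrite mxE -mulrA.
  by under eq_bigr do rewrite -mulr_sumr; rewrite -mulr_sumr X_orth mulr0.
rewrite -[t]addr0 -(X_orth j).
exact: (has_traceD ht (@has_trace_fop_compression m v X j)).
Qed.

(** [P] is the midpoint of its perturbations by [eps *: X] and [- eps *: X]. Both are feasible, so
    extremality makes them equal, and the dual family gives [X = 0]. *)
Lemma extreme_perturb q (beta : 'I_n -> K) (P : H -> H) m (v : 'I_m -> H) X :
  extreme_point (feasible_set dot q A beta) P -> perturbable dot q P v ->
  conj_symmetric X ->
  (forall j, \sum_k \sum_l X k l * conj (compression v j k l) = 0) -> X = 0.
Proof.
move=> [P_feas P_ext] v_pert X_sym X_orth.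
have [[w vw] /choice[u vE] _] := v_pert; have [P_pos _ _] := P_feas.
pose c := (\sum_k \sum_l `|X k l|) * (\sum_k dot (P (u k)) (u k)) : K.
have c_ge0 : 0 <= c.
  apply: mulr_ge0; apply: sumr_ge0 => k _; first by apply: sumr_ge0.
  by rewrite (positive_sym P_pos) (positive_ge0 P_pos).
(* [eps * c <= 1] is the smallness asked by [positive_perturb]; the added 1 keeps [eps] positive
   when [c = 0]. *)
pose eps : K := (1 + c)^-1.
have c1_gt0 : 0 < 1 + c by rewrite ltr_pwDl.
have eps_gt0 : 0 < eps by rewrite invr_gt0.
have eps_real : conj eps = eps by rewrite conj_scalar_real// gtr0_real.
have feas (t : K) : conj t = t -> `|t| = eps ->
    feasible_set dot q A beta (fun x => P x + fop dot v (t *: X) x).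
  move=> t_real t_eps; have tX_sym : conj_symmetric (t *: X).
    by move=> k l; rewrite !mxE conjM t_real -X_sym.
  apply: feasible_perturb => // [j|].
    under eq_bigr do under eq_bigr do rewrite mxE -mulrA.
    by under eq_bigr do rewrite -mulr_sumr; rewrite -mulr_sumr X_orth mulr0.
  apply: (positive_perturb dot_norm P_pos vE tX_sym).
  under eq_bigr do under eq_bigr do rewrite mxE normrM.
  under eq_bigr do rewrite -mulr_sumr.
  rewrite -mulr_sumr -mulrA -/c t_eps ler_pdivrMl// mulr1.
  by rewrite lerDr.
have y_feas : feasible_set dot q A beta (fun x => P x + fop dot v (eps *: X) x).
  by apply: feas => //; rewrite gtr0_norm.
have z_feas : feasible_set dot q A beta (fun x => P x + fop dot v (- eps *: X) x).
  apply: feas; last by rewrite normrN gtr0_norm.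
  by rewrite -[- eps]sub0r conjB conj0 eps_real.
have halfE : 1 - 2^-1 = 2^-1 :> K by field.
have half : (0 : K) < (2^-1 : K) < 1.
  have half_gt0 : (0 : K) < 2^-1 by rewrite invr_gt0.
  by rewrite half_gt0 -subr_gt0 halfE.
have yz := P_ext _ _ _ half y_feas z_feas.
have {}yz : (fun x => P x + fop dot v (eps *: X) x) =
    (fun x => P x + fop dot v (- eps *: X) x).
  apply: yz; apply/funext => x.
  have PxE : P x = (2^-1 : K) *: (P x + fop dot v (eps *: X) x) +
      (1 - 2^-1 : K) *: (P x + fop dot v (- eps *: X) x).
    rewrite halfE -scalerDr !fopZ scaleNr addrACA subrr addr0 -mulr2n.
    by rewrite -[P x *+ 2]scaler_nat scalerA mulVf ?scale1r// pnatr_eq0.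
  exact: PxE.
apply/matrixP => k l; rewrite mxE -(fop_biorth X k l vw).
have /(congr1 (fun f => dot (f (w k)) (w l))) := yz.
rewrite !dotDl !fopZ !dotZl => /addrI/eqP.
rewrite mulNr -addr_eq0 -mulr2n mulrn_eq0/= mulf_eq0 gt_eqF//=.
by move/eqP.
Qed.

(** The vector x - sum_k <x, v_k> w_k lies in the kernel of [P], hence of [y]. So [y] is determined
    by the [y (w k)], and by symmetry by the products <y w_k, w_l>. *)
Lemma dominated_fop (y P : H -> H) m (v w : 'I_m -> H) :
  positive_operator dot y -> P = fop dot v 1%:M -> biorthogonal dot v w ->
  (forall x, P x = 0 -> y x = 0) ->
  y = fop dot v (\matrix_(k, l) dot (y (w k)) (w l)).
Proof.
move=> y_pos PE vw y0; apply/funext => x; have y_lin := positive_linear y_pos.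
have yE x' : y x' = \sum_k dot x' (v k) *: y (w k).
  apply/eqP; rewrite -subr_eq0 -(eq_bigr _ (fun k _ => linZ y_lin _ _)).
  rewrite -(lin_sum y_lin) -(linB y_lin); apply/eqP/y0.
  rewrite PE (linB (fop_linear _ _ _)) (lin_sum (fop_linear _ _ _)) fop_id.
  apply/eqP; rewrite subr_eq0; apply/eqP/eq_bigr => k _.
  by rewrite (linZ (fop_linear _ _ _)) (fop_id_dual _ vw).
apply: (dot_inj (dot := dot)) => t; rewrite dot_fopl yE dot_suml.
apply: eq_bigr => k _; rewrite dotZl (positive_sym y_pos) yE dot_sumr mulr_sumr.
apply: eq_bigr => l _; rewrite mxE dotZr -dotC (positive_sym y_pos).
ring.
Qed.

(** Both parts of a decomposition vanish on the kernel of [P], so they have matrices [Y] and [Z] in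
    the family [v]. Their traces against each A_j agree, so [Y - Z] is orthogonal to all
    compressions. *)
Lemma extreme_of_compression q (beta : 'I_n -> K) (P : H -> H) m (v w : 'I_m -> H) :
  feasible_set dot q A beta P -> P = fop dot v 1%:M -> biorthogonal dot v w ->
  (forall X, conj_symmetric X ->
    (forall j, \sum_k \sum_l X k l * conj (compression v j k l) = 0) -> X = 0) ->
  extreme_point (feasible_set dot q A beta) P.
Proof.
move=> P_feas PE vw X0; split=> // a y z /andP[a_gt0 a_lt1] y_feas z_feas Pyz.
have [y_pos _ y_beta] := y_feas; have [z_pos _ z_beta] := z_feas.
have [P_pos _ _] := P_feas.
have Pyz' x : P x = a *: y x + (1 - a) *: z x by rewrite Pyz.
have a1_gt0 : 0 < 1 - a by rewrite subr_gt0.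
(* <Px, x> = 0 is a combination with positive weights of two nonnegative numbers, so both are 0. *)
have ker x : P x = 0 -> y x = 0 /\ z x = 0.
  move=> Px; have /eqP : dot (P x) x = 0 by rewrite Px dot0l.
  have yx : 0 <= dot (y x) x by rewrite (positive_sym y_pos) (positive_ge0 y_pos).
  have zx : 0 <= dot (z x) x by rewrite (positive_sym z_pos) (positive_ge0 z_pos).
  have ayx := mulr_ge0 (ltW a_gt0) yx; have azx := mulr_ge0 (ltW a1_gt0) zx.
  rewrite Pyz' dotDl !dotZl paddr_eq0// !mulf_eq0.
  rewrite (gt_eqF a_gt0) (gt_eqF a1_gt0) /= => /andP[/eqP y0 /eqP z0].
  by split; [apply: (positive_dot_eq0 (positive_linear y_pos) (positive_sym y_pos)
      (positive_ge0 y_pos))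
    |apply: (positive_dot_eq0 (positive_linear z_pos) (positive_sym z_pos)
      (positive_ge0 z_pos))].
have yE := dominated_fop y_pos PE vw (fun x Px => (ker x Px).1).
have zE := dominated_fop z_pos PE vw (fun x Px => (ker x Px).2).
set Y := \matrix_(_, _) _ in yE; set Z := \matrix_(_, _) _ in zE.
suff YZ : Y - Z = 0.
  by rewrite yE zE; congr fop; apply/eqP; rewrite -subr_eq0 YZ.
apply: X0 => [k l|j].
  rewrite !mxE conjB (positive_sym y_pos) (positive_sym z_pos).
  by rewrite [dot (w l) _]dotC [dot (w l) (z _)]dotC.
have beta_eq f W : f = fop dot v W -> trace dot (f \o A j) = beta j ->
    \sum_k \sum_l W k l * conj (compression v j k l) = beta j.
  move=> -> <-; apply/esym/(trace_unique e_onb).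
  exact: has_trace_fop_compression.
have := beta_eq _ _ yE (y_beta j); rewrite -(beta_eq _ _ zE (z_beta j)).
move=> /eqP; rewrite -subr_eq0 -sumrB => /eqP YZ_orth; rewrite -[RHS]YZ_orth.
apply: eq_bigr => k _; rewrite -sumrB; apply: eq_bigr => l _.
by rewrite -mulrBl; congr (_ * _); rewrite [LHS]mxE; congr (_ + _); rewrite [LHS]mxE.
Qed.

End ExtremePoint.

Theorem theorem3p5 (R : realType) (F : scalar_kind)
    (H : completeNormedModType (scalars R F))
    (dot : {dot H for @conj_scalar R F})
    (dot_norm : forall x : H, dot x x = `|x| ^+ 2)
    (H_separable : separable H)
    (p : R) (q : \bar R) (p_ge1 : 1 <= p)
    (pq_conjugate : (p%:E^-1 + q^-1 = 1)%E)
    (n : nat) (n_gt0 : (0 < n)%N)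
    (A : 'I_n -> H -> H)
    (A_schatten : forall j, schatten dot p%:E (A j))
    (A_selfadjoint : forall j, selfadjoint dot (A j))
    (beta : 'I_n -> scalars R F)
    (P : H -> H) (P_feasible : feasible_set dot q A beta P) :
  extreme_point (feasible_set dot q A beta) P <->
  [/\ finite_rank P,
      F = RealScalars ->
        \rank (\matrix_(i, j) trace dot (P \o A i \o P \o A j))
        = (op_rank P * (1 + op_rank P))./2 &
      F = ComplexScalars ->
        \rank (\matrix_(i, j) trace dot (P \o A i \o P \o A j))
        = (op_rank P ^ 2)%N ].
Proof.
have A_sym j x y : dot (A j x) y = dot x (A j y) by case: (A_selfadjoint j).
have A_lin j : linear (A j) by case: (A_selfadjoint j) => [[]].
(* The Schatten condition on the first operator, which exists as [0 < n], contains an orthonormal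
   basis. *)
have [_ [_ [_ [_ [_ [e [_ [e_onb _ _ _]]]] _]]]] := A_schatten (Ordinal n_gt0).
have [P_pos P_schatten _] := P_feasible.
have rankE m (v : 'I_m -> H) : P = fop dot v 1%:M ->
    \matrix_(i, j) trace dot (P \o A i \o P \o A j) =
    \matrix_(i, j) \sum_k \sum_l compression dot A v i k l *
      conj_scalar (compression dot A v j k l).
  move=> PE; apply/matrixP => i j.
  by rewrite [LHS]mxE [RHS]mxE PE (trace_gram dot_norm A_sym A_lin e_onb).
have herm_dimP r : \rank (\matrix_(i, j) trace dot (P \o A i \o P \o A j)) =
    herm_dim F r <->
  (F = RealScalars -> \rank (\matrix_(i, j) trace dot (P \o A i \o P \o A j)) =
    (r * (1 + r))./2) /\
  (F = ComplexScalars -> \rank (\matrix_(i, j) trace dot (P \o A i \o P \o A j)) =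
    (r ^ 2)%N).
  move: (\rank _) => k; case: (F) => /=; split=> [h|[h1 h2]]; try by split.
    exact: h1.
  exact: h2.
split=> [P_ext|[[r Pr] rankR rankC]].
  have [[v v_pert]|[r [v [v_pert PE]]]] := perturbable_exists dot_norm n.+1 P_pos P_schatten.
    (* With n + 1 vectors the n x n Gram matrix would have rank at least n + 1. *)
    have := (gram_rank_herm (compression_sym A_sym v)).2
      (fun X => extreme_perturb dot_norm A_sym P_ext v_pert (X := X)).
    by move=> h; have := leq_herm_dim F n.+1; rewrite -h leqNgt ltnS rank_leq_row.
  have [[w vw] _ _] := v_pert.
  have Pr : has_rank P r by rewrite PE; exact: (fop_has_rank vw).
  have := (gram_rank_herm (compression_sym A_sym v)).2
    (fun X => extreme_perturb dot_norm A_sym P_ext v_pert (X := X)).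
  rewrite -(rankE _ _ PE) (op_rank_unique Pr) => /herm_dimP[? ?].
  by split=> //; exists r.
(* [P] has rank [r], so there are no [r + 1] independent vectors in its range and the elimination
   must factor [P]. *)
have [[m [v [w [vw PE]]]]|[v [w [vw v_range]]]] := cholesky dot_norm r.+1 P_pos; last first.
  by have := free_range_leq_rank Pr (biorthogonal_free vw) v_range; rewrite ltnn.
have Pm : has_rank P m by rewrite PE; exact: (fop_has_rank vw).
apply: (extreme_of_compression dot_norm A_sym e_onb P_feasible PE vw).
apply/(gram_rank_herm (compression_sym A_sym v)).
rewrite -(rankE _ _ PE); apply/herm_dimP.
by rewrite -(op_rank_unique Pm).
Qed.
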